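(* Consider the stochastic regression model $y_{k+1}=\varphi_k^T\theta+w_{k+1}$, $k\ge0$, with unknown parameter $\theta\in\mathbb{R}^r$ having $d$ nonzero elements ($d$ unknown), where without loss of generality $\theta(i)\ne0$ for $i=1,\dots,d$ and $\theta(j)=0$ for $j=d+1,\dots,r$. Assume: (i) the noise $\{w_k,\mathcal{F}_k\}_{k\ge1}$ is a martingale difference sequence, i.e. $\mathbb{E}[w_{k+1}\mid\mathcal{F}_k]=0$, $k\ge1$, and there exists some $\gamma>2$ such that $\sup_k\mathbb{E}[|w_{k+1}|^\gamma\mid\mathcal{F}_k]<\infty$ a.s.; (ii) $\lim_{n\to\infty}\dfrac{\log R_n}{\lambda_{\min}^n}=0$ a.s. Let $\beta_{n+1}$ be the sparse estimates generated by the thresholded recursive least squares algorithm described in the context. Then there exists $\Omega_0\subseteq\Omega$ with $\mathcal{P}\{\Omega_0\}=1$ such that for any $\omega\in\Omega_0$ there exists an integer $N_0(\omega)$ such that $$\beta_{N+1}(d+1)=\cdots=\beta_{N+1}(r)=0,\qquad N\ge N_0(\omega),$$ i.e. $H_{N+1}=H^*$, where $H^*=\{l\in\{1,\dots,r\}:\theta(l)=0\}$ and $H_{n+1}=\{l\in\{1,\dots,r\}:\beta_{n+1}(l)=0\}$.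
   Context: The probability space is $(\Omega,\mathcal{F},\mathcal{P})$. Here $y_{k+1}$ is the scalar observation, $\varphi_k\in\mathbb{R}^r$ is a stochastic regression vector (which may be a function of current and past inputs and outputs), and $w_{k+1}$ is the scalar noise. $v(l)$ denotes the $l$-th coordinate of a vector $v$, and $\|\cdot\|$ is the 2-norm. Given an initial vector $\theta_0\in\mathbb{R}^r$ and an initial matrix $P_0>0$ (positive definite), set $R_n=1+\sum_{k=0}^n\|\varphi_k\|^2$ and $\lambda_{\min}^n=\lambda_{\min}\{P_0^{-1}+\sum_{k=0}^n\varphi_k\varphi_k^T\}$ (smallest eigenvalue). Thresholds: $\{\alpha_n\}$ is a chosen positive sequence satisfying $\alpha_n\to0$ as $n\to\infty$ and $\sqrt{\log R_n/\lambda_{\min}^n}=o(\alpha_n)$. Algorithm (recursive least squares followed by thresholding): for $k\ge0$, $a_k=\dfrac{1}{1+\varphi_k^TP_k\varphi_k}$, $\;P_{k+1}=P_k-a_kP_k\varphi_k\varphi_k^TP_k$, $\;\theta_{k+1}=\theta_k+a_kP_k\varphi_k\{y_{k+1}-\varphi_k^T\theta_k\}$. The sparse estimate $\beta_{n+1}=(\beta_{n+1}(1),\dots,\beta_{n+1}(r))^T$ is given by $\beta_{n+1}(l)=0$ if $|\theta_{n+1}(l)|<\alpha_{n+1}$, and $\beta_{n+1}(l)=\theta_{n+1}(l)$ otherwise.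
   Formalization: The threshold condition is taken as sqrt(log R_n/lambda_min^n) = o(alpha_{n+1}) instead of o(alpha_n); a.s. some phi_k is nonzero; phi_k is assumed F_k-measurable. The claim fails as printed without these. *)

(* Defs.v *)
From HB Require Import structures.
From mathcomp Require Import all_boot all_order all_algebra.
From mathcomp Require Import all_classical all_reals all_analysis measurable_realfun.

Set Implicit Arguments.
Unset Strict Implicit.
Unset Printing Implicit Defensive.

Import Order.TTheory GRing.Theory Num.Theory.
Import numFieldNormedType.Exports.

Local Open Scope classical_set_scope.
Local Open Scope ring_scope.

(* The library norm on 'cV[R]_r is the sup norm, hence this definition. *)
Definition norm2 (R : realType) (r : nat) (v : 'cV[R]_r) : R :=
  Num.sqrt (\sum_(i < r) v i 0 ^+ 2).

Definition posdefmx (R : realType) (r : nat) (A : 'M[R]_r) : Prop :=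
  A^T = A /\ forall x : 'cV[R]_r, x != 0 -> 0 < (x^T *m A *m x) 0 0.

(* Smallest eigenvalue; only meant for real symmetric A with 0 < r, whose
   spectrum is finite, nonempty and real, so that the infimum is a minimum. *)
Definition lambda_min (R : realType) (r : nat) (A : 'M[R]_r) : R :=
  inf [set a : R | eigenvalue A a].

Section RLS.
Variables (R : realType) (r : nat).
Variables (P0 : 'M[R]_r) (theta0 : 'cV[R]_r).
Variables (phi : nat -> 'cV[R]_r) (y : nat -> R).

Definition regR (n : nat) : R := 1 + \sum_(k < n.+1) norm2 (phi k) ^+ 2.

Definition reg_lambda_min (n : nat) : R :=
  lambda_min (invmx P0 + \sum_(k < n.+1) phi k *m (phi k)^T).

Definition rls_gain (P : 'M[R]_r) (v : 'cV[R]_r) : R :=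
  (1 + (v^T *m P *m v) 0 0)^-1.

Fixpoint rls_P (k : nat) : 'M[R]_r :=
  if k is j.+1 then
    rls_P j - rls_gain (rls_P j) (phi j) *:
      (rls_P j *m phi j *m (phi j)^T *m rls_P j)
  else P0.

Fixpoint rls_theta (k : nat) : 'cV[R]_r :=
  if k is j.+1 then
    rls_theta j + (rls_gain (rls_P j) (phi j)
                   * (y j.+1 - ((phi j)^T *m rls_theta j) 0 0)) *:
      (rls_P j *m phi j)
  else theta0.

Definition sparse_est (alpha : nat -> R) (n : nat) : 'cV[R]_r :=
  \col_l (if `|rls_theta n l 0| < alpha n then 0 else rls_theta n l 0).

End RLS.

Definition zero_set (R : realType) (r : nat) (v : 'cV[R]_r) : set 'I_r :=
  [set l | v l 0 = 0].

Section Stochastic.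
Context (disp : measure_display) (Omega : measurableType disp) (R : realType).

Definition filtration (F : nat -> set (set Omega)) : Prop :=
  [/\ forall k, sigma_algebra setT (F k),
      forall k, F k `<=` measurable &
      forall j k, (j <= k)%N -> F j `<=` F k].

(* f is measurable with respect to the sub-sigma-algebra G. *)
Definition measurable_wrt (disp' : measure_display) (T : measurableType disp')
    (G : set (set Omega)) (f : Omega -> T) : Prop :=
  preimage_set_system setT f measurable `<=` G.

(* Z is a version of E[X | G]; to be used for X integrable or X nonnegative
   measurable (in the latter case Z may take the value +oo). *)
Definition is_cond_exp (P : probability Omega R) (G : set (set Omega))
    (X Z : Omega -> \bar R) : Prop :=
  measurable_wrt G Z /\
  forall A, G A -> (\int[P]_(x in A) Z x = \int[P]_(x in A) X x)%E.

(* The zero function is a version of E[w_{k+1} | F_k] for every k >= 1; the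
   value w 0 plays no role. *)
Definition martingale_difference (P : probability Omega R)
    (F : nat -> set (set Omega)) (w : nat -> Omega -> R) : Prop :=
  [/\ forall k, (1 <= k)%N -> measurable_wrt (F k) (w k),
      forall k, (1 <= k)%N -> P.-integrable setT (EFin \o w k) &
      forall k, (1 <= k)%N ->
        is_cond_exp P (F k) (EFin \o w k.+1) (cst 0%E)].

(* Quantifying existentially over versions is harmless: they exist and are
   almost surely unique. *)
Definition bounded_cond_moment (P : probability Omega R)
    (F : nat -> set (set Omega)) (w : nat -> Omega -> R) (gamma : R) : Prop :=
  exists Z : nat -> Omega -> \bar R,
    (forall k, (1 <= k)%N ->
       is_cond_exp P (F k) (fun x => (`|w k.+1 x| `^ gamma)%:E) (Z k)) /\
    {ae P, forall x,
       (ereal_sup [set Z k x | k in [set k | (1 <= k)%N]] < +oo)%E}.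

End Stochastic.

(* Main.v *)
(* Put z_k = theta_k - theta and Q_k = P_k^-1 = P_0^-1 + sum_(j < k) phi_j phi_j^T.
   The Lyapunov function V_k = z_k^T Q_k z_k satisfies
     V_(k+1) = V_k - a_k u_k^2 + 2 a_k u_k w_(k+1) + (1 - a_k) w_(k+1)^2,
   with u_k = phi_k^T z_k.  The martingale sum_k 2 a_k u_k w_(k+1) is almost
   surely O((1 + S_n)^(3/4)) with S_n = sum_k a_k u_k^2, hence absorbed by
   - S_n; the conditional moment of order gamma > 2 gives
   sum_k (1 - a_k) w_(k+1)^2 = O(1 + sum_k (1 - a_k)); and
   1 - a_k <= - ln a_k = ln (det Q_(k+1) / det Q_k) bounds the last sum by
   O(1 + ln R_n).  Therefore |z_(n+1)|^2 <= V_(n+1) / lambda_min^n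
   = O(ln R_n / lambda_min^n), which is o(alpha_(n+1)^2), and thresholding
   separates the zero coordinates of theta from the others.

   Both growth rates only need boundedness, not convergence, of suitable
   nonnegative supermartingales, i.e. Doob's maximal inequality.  Conditional
   expectations are never formed: conditional inequalities are tested by
   integrating over the sets of the sub-sigma-algebra.  As the bound on the
   conditional moments is random, the noise is first multiplied by the
   indicator of the event that the current conditional moment is at most m. *)

Require Import Defs.
From HB Require Import structures.
From mathcomp Require Import all_boot all_order all_algebra.
From mathcomp Require Import all_classical all_reals all_analysis measurable_realfun.
From mathcomp Require Import perm ring lra.

Set Implicit Arguments.
Unset Strict Implicit.
Unset Printing Implicit Defensive.

Import Order.TTheory GRing.Theory Num.Theory.
Import numFieldNormedType.Exports.

Local Open Scope classical_set_scope.
Local Open Scope ring_scope.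

(** * Measurability with respect to a sub-sigma-algebra *)

Section MeasurableWrt.
Context (disp : measure_display) (Omega : measurableType disp) (R : realType).
Variable G : set (set Omega).
Hypothesis hG : sigma_algebra setT G.
Implicit Types f g : Omega -> R.

(** A sigma-algebra coincides with the one it generates, so closure properties of ordinary
    measurable functions carry over to [measurable_wrt]. *)
Lemma measurable_wrtP d' (T : measurableType d') (f : Omega -> T) :
  measurable_wrt G f <->
  @measurable_fun _ _ (g_sigma_algebraType G) T setT f.
Proof.
split=> [Gf _ B mB|mf A [B mB <-]].
  rewrite -[X in X _]/(@measurable _ (g_sigma_algebraType G)).
  by rewrite measurable_g_measurableTypeE//; apply: Gf; exists B.
by have := mf measurableT B mB; rewrite measurable_g_measurableTypeE.
Qed.

Lemma measurable_wrt_cst (c : R) : measurable_wrt G (fun=> c).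
Proof. by apply/measurable_wrtP; exact: measurable_cst. Qed.

Lemma measurable_wrtD f g : measurable_wrt G f -> measurable_wrt G g ->
  measurable_wrt G (fun x => f x + g x).
Proof. by rewrite !measurable_wrtP => ? ?; exact: measurable_funD. Qed.

Lemma measurable_wrtM f g : measurable_wrt G f -> measurable_wrt G g ->
  measurable_wrt G (fun x => f x * g x).
Proof. by rewrite !measurable_wrtP => ? ?; exact: measurable_funM. Qed.

Lemma measurable_wrt_comp (h : R -> R) f : measurable_fun setT h ->
  measurable_wrt G f -> measurable_wrt G (fun x => h (f x)).
Proof. by rewrite !measurable_wrtP => mh mf; exact: measurableT_comp. Qed.

Lemma measurable_wrtN f : measurable_wrt G f -> measurable_wrt G (fun x => - f x).
Proof. by apply: (@measurable_wrt_comp -%R); exact: oppr_measurable. Qed.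

Lemma measurable_wrtB f g : measurable_wrt G f -> measurable_wrt G g ->
  measurable_wrt G (fun x => f x - g x).
Proof. by move=> mf mg; apply: measurable_wrtD => //; exact: measurable_wrtN. Qed.

Lemma measurable_wrtX f n : measurable_wrt G f ->
  measurable_wrt G (fun x => f x ^+ n).
Proof. by apply: (@measurable_wrt_comp (fun y => y ^+ n)); exact: exprn_measurable. Qed.

Lemma measurable_wrt_powR f (p : R) : measurable_wrt G f ->
  measurable_wrt G (fun x => f x `^ p).
Proof. by apply: (@measurable_wrt_comp (@powR R ^~ p)); exact: measurable_powR. Qed.

Lemma measurable_wrt_max f g : measurable_wrt G f -> measurable_wrt G g ->
  measurable_wrt G (fun x => Num.max (f x) (g x)).
Proof. by rewrite !measurable_wrtP => ? ?; exact: measurable_maxr. Qed.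

Lemma measurable_wrt_inv_ge0 f : (forall x, 0 <= f x) -> measurable_wrt G f ->
  measurable_wrt G (fun x => (f x)^-1).
Proof.
move=> f0 mf; rewrite (_ : (fun x => _) = fun x => f x `^ (-1)).
  exact: measurable_wrt_powR.
by apply/funext => x; rewrite powR_inv1.
Qed.

Lemma measurable_wrt_sum (I : Type) (s : seq I) (f : I -> Omega -> R) :
  (forall i, measurable_wrt G (f i)) ->
  measurable_wrt G (fun x => \sum_(i <- s) f i x).
Proof.
move=> mf; elim: s => [|i s IH].
  rewrite (_ : (fun x => _) = fun=> 0); first exact: measurable_wrt_cst.
  by apply/funext => x; rewrite big_nil.
rewrite (_ : (fun x => _) = fun x => f i x + \sum_(j <- s) f j x).
  exact: measurable_wrtD.
by apply/funext => x; rewrite big_cons.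
Qed.

Lemma measurable_wrt_le f c : measurable_wrt G f -> G [set x | f x <= c].
Proof.
move=> mf; apply: mf; exists [set y | y <= c].
  by rewrite -set_itvNyc; exact: measurable_itv.
by rewrite setTI.
Qed.

Lemma measurable_wrt_ge f c : measurable_wrt G f -> G [set x | c <= f x].
Proof.
move=> mf; apply: mf; exists [set y | c <= y].
  by rewrite -set_itvcy; exact: measurable_itv.
by rewrite setTI.
Qed.

Lemma sigma_algebraI_sub A B : G A -> G B -> G (A `&` B).
Proof.
by rewrite -(sigma_algebra_id hG); exact: (@measurableI _ (g_sigma_algebraType G)).
Qed.

Lemma measurable_wrt_indic (A : set Omega) : G A ->
  measurable_wrt G (\1_A : Omega -> R).
Proof.
move=> GA; apply/measurable_wrtP; apply: (@measurable_indic _ (g_sigma_algebraType G)).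
rewrite -[X in X _]/(@measurable _ (g_sigma_algebraType G)).
by rewrite measurable_g_measurableTypeE.
Qed.

Lemma measurable_wrt_measurable d' (T : measurableType d') (f : Omega -> T) :
  G `<=` measurable -> measurable_wrt G f -> measurable_fun setT f.
Proof. by move=> Gm Gf _ B mB; apply: Gm; apply: Gf; exists B. Qed.

End MeasurableWrt.

Lemma measurable_wrtS (disp : measure_display) (Omega : measurableType disp)
    (G H : set (set Omega)) d' (T : measurableType d') (f : Omega -> T) :
  G `<=` H -> measurable_wrt G f -> measurable_wrt H f.
Proof. by move=> GH Gf A /Gf /GH. Qed.

(** * Conditional drift and the maximal inequality *)

Section Drift.
Context (disp : measure_display) (Omega : measurableType disp) (R : realType).
Variable P : probability Omega R.

(** Encodes E[eta | G] <= 0 almost surely through integrals over the sets of [G]. *)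
Definition nonpos_drift (G : set (set Omega)) (eta : Omega -> R) : Prop :=
  P.-integrable setT (EFin \o eta) /\
  forall A, G A -> \int[P]_(x in A) eta x <= 0.

Lemma integrable_scale (A : set Omega) (f : Omega -> R) (M : R) :
  measurable A -> P.-integrable A (EFin \o f) ->
  P.-integrable A (EFin \o (fun x => M * f x)).
Proof.
move=> mA intf.
by move: (integrableZl mA M intf); apply: eq_integrable => // x _ /=; rewrite EFinM.
Qed.

Lemma integrable_bounded_mul (A : set Omega) (g eta : Omega -> R) (M : R) :
  measurable A -> measurable_fun setT g -> (forall x, A x -> `|g x| <= M) ->
  P.-integrable setT (EFin \o eta) ->
  P.-integrable A (EFin \o (fun x => g x * eta x)).
Proof.
move=> mA mg gM ieta.
have -> : EFin \o (fun x => g x * eta x) = ((EFin \o g) \* (EFin \o eta))%E by [].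
apply: integrableMr => //.
- exact: measurable_funS mg.
- exists M; split; first exact: num_real.
  by move=> N MN x Ax; apply: le_trans (gM _ Ax) (ltW MN).
- exact: integrableS ieta.
Qed.

(* Bisection of the range of [g]: subtracting [M / 2] times the indicator of
   [M / 2 <= g] leaves a weight bounded by [M / 2]. *)
Lemma weighted_drift_bisect (G : set (set Omega)) (eta : Omega -> R)
    (A : set Omega) (n : nat) (g : Omega -> R) (M : R) :
  sigma_algebra setT G -> G `<=` measurable -> nonpos_drift G eta ->
  G A -> measurable_wrt G g -> (forall x, A x -> 0 <= g x <= M) -> 0 <= M ->
  \int[P]_(x in A) (g x * eta x) <=
    M / 2 ^+ n * \int[P]_(x in A) `|eta x|.
Proof.
move=> sG Gm [ieta dr] GA; have mA := Gm _ GA.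
have iA : P.-integrable A (EFin \o eta) by exact: integrableS ieta.
have iAn : P.-integrable A (EFin \o (fun x => `|eta x|)) by exact: integrable_norm iA.
elim: n g M => [|n IH] g M mg g0M M0.
  have mg' := measurable_wrt_measurable Gm mg.
  rewrite expr0 divr1 -RintegralZl//; apply: le_Rintegral => //.
  - apply: (integrable_bounded_mul (M := M)) => // x /g0M/andP[? ?].
    by rewrite ger0_norm.
  - exact: integrable_scale.
  - move=> x /g0M/andP[gx0 gxM].
    rewrite (le_trans (ler_norm _))// normrM (ger0_norm gx0).
    by rewrite ler_wpM2r.
pose B := [set x | M / 2 <= g x].
have GB : G B by exact: measurable_wrt_ge.
pose g' x := g x - M / 2 * \1_B x.
have mg'G : measurable_wrt G g'.
  apply: measurable_wrtB => //; apply: measurable_wrtM => //.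
    exact: measurable_wrt_cst.
  exact: measurable_wrt_indic.
have g'0M x : A x -> 0 <= g' x <= M / 2.
  move=> /g0M/andP[gx0 gxM]; rewrite /g' indicE.
  have [h|h] := pselect (B x); first by rewrite (mem_set h); move: h; rewrite /B /=; lra.
  by rewrite (memNset h); move/negP: h; rewrite /B /= -ltNge; lra.
have := IH _ _ mg'G g'0M ltac:(lra).
have -> : M / 2 / 2 ^+ n = M / 2 ^+ n.+1 by rewrite exprS invfM mulrA.
apply: le_trans.
have i1 : P.-integrable A (EFin \o (fun x => g' x * eta x)).
  apply: (integrable_bounded_mul (M := M / 2)) => //.
    exact: measurable_wrt_measurable mg'G.
  by move=> x /g'0M/andP[? ?]; rewrite ger0_norm.
have i3 : P.-integrable A (EFin \o (eta \_ B)).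
  rewrite -restrict_EFin; apply/integrable_restrict => //; first exact: Gm.
  apply: integrableS ieta => //; apply: measurableI => //; exact: Gm.
have i2 : P.-integrable A (EFin \o (fun x => M / 2 * (eta \_ B) x)).
  exact: integrable_scale.
rewrite (@eq_Rintegral _ _ _ _ _ (fun x => g' x * eta x + M / 2 * (eta \_ B) x)).
  rewrite RintegralD// RintegralZl// -Rintegral_mkcondr.
  have := dr _ (sigma_algebraI_sub sG GA GB); move: M0 => ? ?.
  by rewrite gerDl mulr_ge0_le0// divr_ge0.
move=> x _; rewrite /g' /patch indicE; case: ifPn => _; rewrite ?mulr1 ?mulr0; ring.
Qed.

(** The bisection bound holds for every [n] and its right-hand side tends to 0. This is the rule
    that a nonnegative bounded [G]-measurable factor can be pulled out of a conditional
    expectation. *)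
Lemma weighted_drift (G : set (set Omega)) (eta : Omega -> R)
    (A : set Omega) (g : Omega -> R) (M : R) :
  sigma_algebra setT G -> G `<=` measurable -> nonpos_drift G eta ->
  G A -> measurable_wrt G g -> (forall x, A x -> 0 <= g x <= M) ->
  P.-integrable A (EFin \o (fun x => g x * eta x)) /\
  \int[P]_(x in A) (g x * eta x) <= 0.
Proof.
move=> sG Gm deta GA mg g0M; split.
  apply: (integrable_bounded_mul (M := M)).
  - exact: Gm.
  - exact: measurable_wrt_measurable mg.
  - by move=> x /g0M/andP[? ?]; rewrite ger0_norm.
  - by case: deta.
(* When [A] is empty the bounds on [g] say nothing about the sign of [M], hence the absolute
   value. *)
have g0M' x : A x -> 0 <= g x <= `|M|.
  by move=> /g0M/andP[-> /le_trans]; apply; exact: ler_norm.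
set I := \int[P]_(x in A) `|eta x|.
have h n := weighted_drift_bisect n sG Gm deta GA mg g0M' (normr_ge0 M).
rewrite -/I in h; set J := Rintegral _ _ _ in h *.
have I0 : 0 <= I by apply: Rintegral_ge0.
rewrite leNgt; apply/negP => J0.
(* Since n < 2 ^ n, this choice makes the bisection bound smaller than [J], contradicting
   [J > 0]. *)
pose n := (Num.truncn (`|M| * I / J)).+1.
have : J < J; last by rewrite ltxx.
apply: le_lt_trans (h n) _.
rewrite mulrAC ltr_pdivrMr ?exprn_gt0//.
rewrite -ltr_pdivrMl// mulrC.
apply: lt_trans (truncnS_gt _) _.
rewrite -natrX ltr_nat; exact: ltn_expl.
Qed.

End Drift.

(** * Almost sure boundedness of nonnegative supermartingales *)

Section Supermartingale.
Context (disp : measure_display) (Omega : measurableType disp) (R : realType).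
Variables (P : probability Omega R) (F : nat -> set (set Omega)).
Hypothesis hF : filtration F.

(** The event that the first passage of [X] above [c] has not happened by time [n]; it stands in for
    a stopping time. *)
Let sub_le (X : nat -> Omega -> R) (c : R) (n : nat) : set Omega :=
  [set x | forall k, (k <= n)%N -> X k x <= c].

Lemma sub_le_measurable X c n : (forall k, measurable_wrt (F k) (X k)) ->
  F n (sub_le X c n).
Proof.
case: hF => sF Fm Fmono mX; elim: n => [|n IH].
  rewrite (_ : sub_le X c 0 = [set x | X 0%N x <= c]).
    exact: measurable_wrt_le.
  apply/seteqP; split=> x /=; first exact.
  by move=> h k; rewrite leqn0 => /eqP ->.
rewrite (_ : sub_le X c n.+1 = sub_le X c n `&` [set x | X n.+1 x <= c]).
  apply: sigma_algebraI_sub => //; last exact: measurable_wrt_le.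
  exact: (Fmono n).
apply/seteqP; split=> x /=.
  by move=> h; split; [move=> k kn; apply: h; exact: leqW|exact: h].
by move=> [h1 h2] k; rewrite leq_eqVlt => /orP[/eqP -> //|]; rewrite ltnS; exact: h1.
Qed.

(* Doob's maximal inequality; only sets on which [X n] is bounded are tested,
   so that no integrability of [X n] itself is involved. *)
Lemma nneg_supermartingale_bounded (X : nat -> Omega -> R) (X0 : R) :
  (forall n, measurable_wrt (F n) (X n)) ->
  (forall n x, 0 <= X n x) -> (forall x, X 0%N x <= X0) ->
  (forall n c A, F n A -> (forall x, A x -> X n x <= c) ->
     P.-integrable A (EFin \o X n.+1) /\
     \int[P]_(x in A) X n.+1 x <= \int[P]_(x in A) X n x) ->
  {ae P, forall x, exists C : R, forall n, X n x <= C}.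
Proof.
move=> mX X0_ge0 XX0 hX.
have [sF Fm Fmono] := hF.
have X00 : 0 <= X0 by apply: le_trans (XX0 point); exact: X0_ge0.
have FA c n := sub_le_measurable c n mX.
have mA c n : measurable (sub_le X c n) by apply: (Fm n); exact: FA.
have mXn n : measurable_fun setT (X n) by exact: measurable_wrt_measurable (Fm n) (mX n).
have bint n c A : measurable A -> (forall x, A x -> X n x <= c) ->
    P.-integrable A (EFin \o X n).
  move=> mA' Xc; apply: measurable_bounded_integrable => //.
  - by rewrite ltey_eq fin_num_measure.
  - exact: measurable_funS (mXn n).
  - exists c; split; first exact: num_real.
    by move=> N cN x /Xc h; rewrite /= ger0_norm// (le_trans h (ltW cN)).
(* The left side is the mean of the process frozen at the value [c] from its first passage on; it
   does not increase with [n]. *)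
have key c n : 0 <= c -> \int[P]_(x in sub_le X c n) X n x
    + c * fine (P (~` sub_le X c n)) <= X0.
  move=> c0; elim: n => [|n IH].
    have m0 : measurable (sub_le X c 0) by [].
    have h1 : \int[P]_(x in sub_le X c 0) X 0%N x <= X0 * fine (P (sub_le X c 0)).
      rewrite -Rintegral_cst//; apply: le_Rintegral => //.
      - by apply: (bint _ c) => // x /= /(_ 0%N); apply.
      - exact: finite_measure_integrable_cst.
    have h2 : c * fine (P (~` sub_le X c 0)) <= X0 * fine (P (~` sub_le X c 0)).
      (* If [c] exceeds the deterministic bound [X0], no path starts above [c] and the complement is
         empty. *)
      have [cX|Xc] := leP c X0; first by rewrite ler_wpM2r// fine_ge0.
      rewrite (_ : ~` _ = set0) ?measure0 ?mulr0//.
      rewrite -subset0 => x /=; apply => k; rewrite leqn0 => /eqP ->.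
      exact: le_trans (XX0 x) (ltW Xc).
    apply: (le_trans (lerD h1 h2)); rewrite -mulrDr ler_piMr//.
    rewrite probability_setC// -[P (sub_le X c 0)]fineK ?fin_num_measure//=.
    by lra.
  apply: le_trans IH.
  have An : sub_le X c n.+1 `<=` sub_le X c n.
    by move=> x /= h k kn; apply: h; exact: leqW.
  have [i1 le1] := hX n c _ (FA c n) (fun x h => h n (leqnn n)).
  (* These paths cross [c] exactly at time [n.+1]; there [X n.+1 > c], so their share of the
     integral covers the growth of the passage term. *)
  have mD : measurable (sub_le X c n `\` sub_le X c n.+1) by exact: measurableD.
  have dcmp : sub_le X c n = sub_le X c n.+1 `|` (sub_le X c n `\` sub_le X c n.+1).
    apply/seteqP; split=> x; last by move=> [/An|[]].
    by move=> xn; have [|] := pselect (sub_le X c n.+1 x); [left|right].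
  apply: le_trans (lerD le1 (lexx _)).
  have -> : \int[P]_(x in sub_le X c n) X n.+1 x =
     \int[P]_(x in sub_le X c n.+1) X n.+1 x +
     \int[P]_(x in sub_le X c n `\` sub_le X c n.+1) X n.+1 x.
    rewrite {1}dcmp Rintegral_setU//; first by rewrite -dcmp.
    by apply/disj_setPS => x [? []].
  rewrite -addrA lerD2l.
  have h3 : c * fine (P (sub_le X c n `\` sub_le X c n.+1)) <=
      \int[P]_(x in sub_le X c n `\` sub_le X c n.+1) X n.+1 x.
    rewrite -Rintegral_cst//; apply: le_Rintegral => //.
    - exact: finite_measure_integrable_cst.
    - exact: integrableS i1.
    - move=> x [xn xn1]; rewrite leNgt; apply/negP => xc; apply: xn1 => k.
      by rewrite leq_eqVlt => /orP[/eqP ->|]; [exact: ltW|exact: xn].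
  apply: le_trans (lerD h3 (lexx _)).
  rewrite -mulrDr ler_wpM2l// -fineD ?fin_num_measure//; last exact: measurableC.
  rewrite fine_le ?fin_num_measure//; first exact: measurableC.
    by rewrite fin_numD ?fin_num_measure//; exact: measurableC.
  rewrite -measureU//; [|exact: measurableC|].
    apply: le_measure; rewrite ?inE; [exact: measurableC| |].
      by apply: measurableU => //; exact: measurableC.
    by move=> x nx; have [|] := pselect (sub_le X c n x); [left|right].
  by rewrite setDE setIC setIA setICl set0I.
have mU c : measurable (\bigcap_n sub_le X c n) by apply: bigcapT_measurable.
(* The paths that pass above every integer level. Passage above [m.+1] has probability at most
   [X0 / m.+1], by continuity from below, so the intersection is null. *)
exists (\bigcap_(m in [set: nat]) ~` (\bigcap_n sub_le X m.+1%:R n)); split.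
- by apply: bigcapT_measurable => m; exact: measurableC.
- set N := \bigcap_(_ in _) _.
  have mN : measurable N by apply: bigcapT_measurable => m; exact: measurableC.
  have PN m : (P N <= (X0 / m.+1%:R)%:E)%E.
    apply: (@le_trans _ _ (P (~` (\bigcap_n sub_le X m.+1%:R n)))).
      by apply: le_measure; rewrite ?inE//; [exact: measurableC|move=> x; apply].
    rewrite setC_bigcap.
    have cv : P (~` sub_le X m.+1%:R n) @[n --> \oo] -->
        P (\bigcup_n ~` sub_le X m.+1%:R n).
      apply: nondecreasing_cvg_mu => //.
      - by move=> i; exact: measurableC.
      - by apply: bigcup_measurable => i _; exact: measurableC.
      - move=> i j ij; apply/subsetPset; apply: subsetC => x h k ki.
        by apply: h; exact: leq_trans ij.
    apply: (cvge_to_le cv); apply: nearW => i.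
    have mC : measurable (~` sub_le X m.+1%:R i) by exact: measurableC.
    rewrite -[leLHS]fineK ?fin_num_measure// lee_fin ler_pdivlMr// mulrC.
    have := @key m.+1%:R i ltac:(by []).
    apply: le_trans; rewrite lerDr; apply: Rintegral_ge0 => x _.
    exact: X0_ge0.
  apply/eqP; rewrite eq_le measure_ge0 andbT.
  apply/lee_addgt0Pr => e e0; rewrite add0e.
  apply: le_trans (PN (Num.truncn (X0 / e))) _.
  rewrite lee_fin ler_pdivrMr// mulrC -ler_pdivrMr//.
  exact/ltW/truncnS_gt.
- move=> x; apply: contra_notP => /existsNP[m]; rewrite /setC /= => h.
  have {}h : (\bigcap_n sub_le X m.+1%:R n) x by apply: contrapT => ?; exact: h.
  by exists m.+1%:R => n; apply: (h n).
Qed.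

End Supermartingale.

(** * Almost sure growth of martingale transforms *)

Section PowerInequalities.
Context (R : realType).
Implicit Types a b q s u v x y : R.

(** Young's inequality for the product of [y ^ q] and 1 with exponents [1 / q] and [1 / (1 - q)];
    the endpoint [q = 1] is separate. *)
Lemma bernoulli_powR q y : 0 < q -> q <= 1 -> 0 <= y -> y `^ q <= 1 + q * (y - 1).
Proof.
move=> q0; rewrite le_eqVlt => /orP[/eqP ->|q1] y0; first by rewrite powRr1//; lra.
have q'0 : 0 < 1 - q by lra.
have := @conjugate_powR R (y `^ q) 1 q^-1 (1 - q)^-1 (powR_ge0 _ _) ler01.
rewrite !invr_gt0 !invrK mulr1 powR1 -powRrM mulfV ?gt_eqF// powRr1//.
by move=> /(_ q0 q'0 ltac:(lra)); lra.
Qed.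

(** The ratio t = s / v lies in [0, 1], where t <= t ^ q. *)
Lemma le_powR_ratio q s v : 0 < q -> q <= 1 -> 0 <= s -> s <= v -> 0 < v ->
  s / v * v `^ q <= s `^ q.
Proof.
move=> q0 q1 s0 sv v0.
have -> : s `^ q = (s / v) `^ q * v `^ q.
  by rewrite -powRM ?divr_ge0 ?(ltW v0)// divfK// gt_eqF.
rewrite ler_wpM2r ?powR_ge0//.
move: s0; rewrite le_eqVlt => /orP[/eqP <-|s0].
  by rewrite mul0r powR_ge0.
by apply: ger1_powR => //; rewrite divr_gt0//= ler_pdivrMr// mul1r.
Qed.

Lemma powR_subadditive q a b : 0 < q -> q <= 1 -> 0 <= a -> 0 <= b ->
  (a + b) `^ q <= a `^ q + b `^ q.
Proof.
move=> q0 q1 a0 b0.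
have [ab0|] := ltP 0 (a + b); last first.
  move=> h; have -> : a = 0 by lra.
  have -> : b = 0 by lra.
  by rewrite addr0 powR0 ?gt_eqF// addr0.
have h1 := @le_powR_ratio q a (a + b) q0 q1 a0 ltac:(lra) ab0.
have h2 := @le_powR_ratio q b (a + b) q0 q1 b0 ltac:(lra) ab0.
apply: le_trans (lerD h1 h2).
by rewrite -mulrDl -mulrDl divff ?gt_eqF// mul1r.
Qed.

Lemma powR1D q y : 0 < q -> 0 <= y -> y `^ (1 + q) = y * y `^ q.
Proof.
by move=> q0 y0; rewrite powRD ?powRr1//; apply/implyP; rewrite gt_eqF// addr_gt0.
Qed.

(** First-order Taylor bound for the function max(., 0) ^ (1 + q), whose derivative is Hölder of
    order [q]; the remainder therefore has order 1 + q. In the supermartingale step the linear term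
    is the one with nonpositive drift. *)
Lemma powR_pos_part_le q u x : 0 < q -> q <= 1 ->
  Num.max (u + x) 0 `^ (1 + q) <=
    Num.max u 0 `^ (1 + q) + (1 + q) * Num.max u 0 `^ q * x + 2 * `|x| `^ (1 + q).
Proof.
move=> q0 q1; have p0 : 0 <= 1 + q by lra.
have m0 (z : R) : Num.max z 0 \is Num.nneg by rewrite nnegrE le_max lexx orbT.
set v := Num.max u 0; have v0 : 0 <= v by rewrite le_max lexx orbT.
apply: (@le_trans _ _ (Num.max (v + x) 0 `^ (1 + q))).
  apply: ge0_ler_powR => //.
  rewrite ge_max; apply/andP; split; last by rewrite le_max lexx orbT.
  by rewrite le_max lerD2r /v le_max lexx.
move: v0; rewrite le_eqVlt => /orP[/eqP <-|v0].
  rewrite add0r !powR0 ?gt_eqF//; last lra.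
  rewrite mulr0 mul0r !add0r.
  apply: (@le_trans _ _ (`|x| `^ (1 + q))).
    apply: ge0_ler_powR => //; rewrite ?nnegrE//.
    by rewrite ge_max normr_ge0 ler_norm.
  by have := powR_ge0 `|x| (1 + q); lra.
(* The concave power lies below its tangent at [v]: Bernoulli at the ratio (v + x) / v, cleared of
   denominators. *)
have Bern : 0 <= v + x -> v * (v + x) `^ q <= v `^ q * (v + q * x).
  move=> vx0.
  have := @bernoulli_powR q ((v + x) / v) q0 q1 (divr_ge0 vx0 (ltW v0)).
  rewrite powRM ?invr_ge0 ?(ltW v0)// -powR_inv1 ?(ltW v0)// powRAC -/(powR _ _).
  have vq := powR_gt0 q v0.
  rewrite powR_inv1 ?(ltW vq)// powR_inv1 ?(ltW v0)// ler_pdivrMr//.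
  move=> /(ler_wpM2l (ltW v0)) h; apply: (le_trans h).
  by rewrite le_eqVlt; apply/orP; left; apply/eqP; field; rewrite gt_eqF.
have [x0|x0] := leP 0 x.
  rewrite max_l; last lra.
  rewrite ger0_norm// !powR1D ?(ltW v0)//; last lra.
  have h1 := Bern ltac:(lra).
  have h2 := @powR_subadditive q v x q0 q1 (ltW v0) x0.
  have h3 : x * (v + x) `^ q <= x * (v `^ q + x `^ q) by rewrite ler_wpM2l.
  have h4 : 0 <= x * x `^ q by rewrite mulr_ge0 ?powR_ge0.
  by lra.
rewrite ltr0_norm//; set s := - x; have s0 : 0 < s by rewrite /s; lra.
have xE : x = - s by rewrite /s; lra.
rewrite xE in Bern *; have vq := powR_ge0 v q; have sq := powR_ge0 s q.
have v0' := ltW v0; have s0' := ltW s0.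
(* For a downward step of size [s], either the sum stays nonnegative and the tangent bound applies,
   or the left side vanishes and the linear term is dominated by the remainder. *)
have [sv|vs] := leP s v.
  rewrite max_l; last lra.
  rewrite !powR1D ?(ltW v0) ?(ltW s0)//; last lra.
  have h1 := Bern ltac:(lra).
  have h2 := @le_powR_ratio q s v q0 q1 (ltW s0) sv v0.
  have h3 : (v - s) * (v - s) `^ q <= (v - s) * (v `^ q * (v + q * - s) / v).
    by rewrite ler_wpM2l ?ler_pdivlMr//; [lra|rewrite mulrC].
  apply: (le_trans h3).
  have -> : (v - s) * (v `^ q * (v + q * - s) / v) =
     v * v `^ q - (1 + q) * (v `^ q * s) + q * s * (s / v * v `^ q).
    by field; rewrite gt_eqF.
  have h4 : q * s * (s / v * v `^ q) <= 1 * s * s `^ q.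
    by apply: ler_pM => //; [rewrite mulr_ge0// ltW|rewrite !mulr_ge0// invr_ge0|
      rewrite ler_wpM2r].
  have : 0 <= s * s `^ q by rewrite mulr_ge0//; lra.
  by lra.
rewrite max_r; last lra.
rewrite powR0 ?gt_eqF//; last lra.
rewrite !powR1D ?(ltW v0) ?(ltW s0)//.
have h1 : v `^ q <= s `^ q.
  by apply: ge0_ler_powR; rewrite ?nnegrE//; lra.
have h2 : (1 + q) * (v `^ q * s) <= 2 * (s `^ q * s).
  by apply: ler_pM; [lra|rewrite mulr_ge0|lra|rewrite ler_wpM2r].
have : 0 <= v * v `^ q by rewrite mulr_ge0//; lra.
by lra.
Qed.

(** Bernoulli at the ratio s / (s + b). It bounds the compensator of each step by a telescoping
    difference. *)
Lemma powR_neg_telescope q s b : 0 < q -> q <= 1 -> 0 < s -> 0 <= b ->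
  q * (b * (s + b) `^ (- (1 + q))) <= s `^ (- q) - (s + b) `^ (- q).
Proof.
move=> q0 q1 s0 b0; set s' := s + b; have s'0 : 0 < s' by rewrite /s'; lra.
have := @bernoulli_powR q (s / s') q0 q1 (divr_ge0 (ltW s0) (ltW s'0)).
have -> : (s / s') `^ q = s' `^ (- q) / s `^ (- q).
  rewrite powRM ?invr_ge0 ?ltW// -powR_inv1 ?ltW// -powRrM mulN1r.
  by rewrite mulrC; congr (_ * _); rewrite powRN invrK.
have A0 := powR_gt0 (- q) s0; have A'0 := powR_gt0 (- q) s'0.
have A'A : s' `^ (- q) <= s `^ (- q).
  rewrite !powRN lef_pV2 ?posrE ?powR_gt0//.
  by apply: ge0_ler_powR; rewrite ?nnegrE /s'; lra.
rewrite ler_pdivrMr//.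
have -> : s / s' - 1 = - (b / s') by rewrite /s'; field; rewrite gt_eqF.
have -> : s' `^ (- (1 + q)) = s' `^ (- q) / s'.
  rewrite addrC opprD powRD ?powR_inv1 ?(ltW s'0)//.
  by rewrite (gt_eqF s'0) implybT.
have h : b / s' * s' `^ (- q) <= b / s' * s `^ (- q).
  by rewrite ler_wpM2l// divr_ge0// ltW.
have := ler_wpM2l (ltW q0) h; lra.
Qed.

End PowerInequalities.

(** * Growth rates obtained from explicit nonnegative supermartingales *)

Section Growth.
Context (disp : measure_display) (Omega : measurableType disp) (R : realType).
Variable P : probability Omega R.

(** The one-step condition of the maximal inequality. The known part [B] is bounded on [A], and [X']
    lies between 0 and [B + D], which gives its integrability on [A] as well. *)
Lemma dominated_drift (G : set (set Omega)) (A : set Omega)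
    (X X' B D : Omega -> R) (c : R) :
  sigma_algebra setT G -> G `<=` measurable -> G A ->
  measurable_wrt G X -> measurable_wrt G B -> measurable_fun setT X' ->
  (forall x, 0 <= X' x) -> (forall x, A x -> 0 <= B x <= X x) ->
  (forall x, A x -> X x <= c) ->
  (forall x, A x -> X' x <= B x + D x) ->
  P.-integrable A (EFin \o D) -> \int[P]_(x in A) D x <= 0 ->
  P.-integrable A (EFin \o X') /\
  \int[P]_(x in A) X' x <= \int[P]_(x in A) X x.
Proof.
move=> sG Gm GA mX mB mX' X'0 BX Xc X'BD iD D0.
have mA := Gm _ GA.
have bint (f : Omega -> R) : measurable_wrt G f -> (forall x, A x -> 0 <= f x <= c) ->
    P.-integrable A (EFin \o f).
  move=> mf f0c; apply: measurable_bounded_integrable => //.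
  - by rewrite ltey_eq fin_num_measure.
  - exact: measurable_funS (measurable_wrt_measurable Gm mf).
  - exists c; split; first exact: num_real.
    by move=> N cN x /f0c/andP[? h]; rewrite /= ger0_norm// (le_trans h (ltW cN)).
have iX : P.-integrable A (EFin \o X).
  by apply: bint => // x Ax; rewrite Xc// andbT; have /andP[/le_trans] := BX x Ax; apply.
have iB : P.-integrable A (EFin \o B).
  by apply: bint => // x Ax; have /andP[-> /le_trans] := BX x Ax; apply; exact: Xc.
have iBD : P.-integrable A (EFin \o (fun x => B x + D x)).
  by move: (integrableD mA iB iD); apply: eq_integrable.
have iX' : P.-integrable A (EFin \o X').
  apply: le_integrable iBD => //.
    by apply/measurable_EFinP; exact: measurable_funS mX'.
  by move=> x Ax /=; rewrite lee_fin !ger0_norm ?X'BD//; apply: le_trans (X'BD x Ax).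
split => //.
apply: (@le_trans _ _ (\int[P]_(x in A) (B x + D x))).
  exact: le_Rintegral.
rewrite RintegralD// -[leRHS]addr0 lerD//.
by apply: le_Rintegral => // x /BX/andP[].
Qed.

Lemma drift_on_add (A : set Omega) (D1 D2 : Omega -> R) : measurable A ->
  P.-integrable A (EFin \o D1) /\ \int[P]_(x in A) D1 x <= 0 ->
  P.-integrable A (EFin \o D2) /\ \int[P]_(x in A) D2 x <= 0 ->
  P.-integrable A (EFin \o (fun x => D1 x + D2 x)) /\
  \int[P]_(x in A) (D1 x + D2 x) <= 0.
Proof.
move=> mA [i1 h1] [i2 h2]; split; last by rewrite RintegralD//; lra.
by move: (integrableD mA i1 i2); apply: eq_integrable.
Qed.


Variable F : nat -> set (set Omega).
Hypothesis hF : filtration F.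

Lemma measurable_wrt_psum (f : nat -> Omega -> R) (n m : nat) :
  (forall k, (k < n)%N -> measurable_wrt (F m) (f k)) ->
  measurable_wrt (F m) (fun x => \sum_(k < n) f k x).
Proof.
move=> mf; have [sF _ _] := hF.
elim: n mf => [|n IH] mf.
  rewrite (_ : (fun x => _) = fun=> 0); last by apply/funext => x; rewrite big_ord0.
  exact: measurable_wrt_cst.
rewrite (_ : (fun x => _) = fun x => \sum_(k < n) f k x + f n x); last first.
  by apply/funext => x; rewrite big_ord_recr.
apply: measurable_wrtD => //; last exact: mf.
by apply: IH => k kn; apply: mf; exact: ltnW.
Qed.

(** With a and b the two square roots, the right side minus the left is (b - a) ^ 2 (2 b + a) / (a b
    ^ 3). *)
Lemma inv_sqrt_telescope (s h : R) : 1 <= s ->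
  h ^+ 2 * (Num.sqrt (s + h ^+ 2))^-1 ^+ 3 <=
    2 * ((Num.sqrt s)^-1 - (Num.sqrt (s + h ^+ 2))^-1).
Proof.
move=> s1; have h2 := sqr_ge0 h.
have s'E := sqr_sqrtr (_ : 0 <= s + h ^+ 2); have sE := sqr_sqrtr (_ : 0 <= s).
have := ler_sqrt s (_ : 0 <= s + h ^+ 2).
have : 0 < Num.sqrt s by rewrite sqrtr_gt0; lra.
have : 0 < Num.sqrt (s + h ^+ 2) by rewrite sqrtr_gt0; lra.
move: s'E sE => /(_ ltac:(lra)) + /(_ ltac:(lra)).
set a := Num.sqrt s; set b := Num.sqrt _ => bE aE b0 a0 /(_ ltac:(lra)).
rewrite (_ : s <= _); last lra; move=> /esym ab.
have -> : h ^+ 2 = b ^+ 2 - a ^+ 2 by rewrite bE aE; ring.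
rewrite -subr_ge0.
have -> : 2 * (a^-1 - b^-1) - (b ^+ 2 - a ^+ 2) * b^-1 ^+ 3 =
   (b - a) ^+ 2 * (2 * b + a) / (a * b ^+ 3).
  by field; rewrite !gt_eqF.
apply: divr_ge0; apply: mulr_ge0; rewrite ?sqr_ge0 ?exprn_ge0//; lra.
Qed.

(* [M_n ^ 2 / s_n ^ (3 / 2) + 2 K / s_n ^ (1 / 2)] is a nonnegative
   supermartingale. *)
Lemma martingale_transform_growth (e h : nat -> Omega -> R) (K : R) :
  0 <= K ->
  (forall n, measurable_wrt (F n.+1) (e n)) ->
  (forall n, measurable_wrt (F n) (h n)) ->
  (forall n, nonpos_drift P (F n) (e n)) ->
  (forall n, nonpos_drift P (F n) (fun x => - e n x)) ->
  (forall n, nonpos_drift P (F n) (fun x => e n x ^+ 2 - K)) ->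
  {ae P, forall x, exists C : R, forall n : nat,
    let s := 1 + \sum_(k < n) h k x ^+ 2 in
    (\sum_(k < n) h k x * e k x) ^+ 2 <= C * Num.sqrt s ^+ 3}.
Proof.
move=> K0 me mh de dNe de2.
have [sF Fm Fmono] := hF.
pose s n x := 1 + \sum_(k < n) h k x ^+ 2.
pose M n x := \sum_(k < n) h k x * e k x.
pose r n x := (Num.sqrt (s n x))^-1.
have s1 n x : 1 <= s n x by rewrite lerDl sumr_ge0// => k _; exact: sqr_ge0.
have sS n x : s n.+1 x = s n x + h n x ^+ 2 by rewrite /s big_ord_recr/= addrA.
have MS n x : M n.+1 x = M n x + h n x * e n x by rewrite /M big_ord_recr.
have r0 n x : 0 < r n x by rewrite invr_gt0 sqrtr_gt0; have := s1 n x; lra.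
have r1 n x : r n x <= 1.
  rewrite invf_le1; last by rewrite sqrtr_gt0; have := s1 n x; lra.
  by rewrite -[leLHS]sqrtr1 ler_sqrt//; have := s1 n x; lra.
have rr n x : r n.+1 x <= r n x.
  rewrite lef_pV2 ?posrE ?sqrtr_gt0 ?(lt_le_trans ltr01)//.
  by rewrite ler_sqrt ?(le_trans ler01)// sS lerDl sqr_ge0.
have tele n x : h n x ^+ 2 * r n.+1 x ^+ 3 <= 2 * (r n x - r n.+1 x).
  by rewrite /r sS; exact: inv_sqrt_telescope.
(* [s n] involves [h k] for [k < n] only, so it is predictable: [s n.+1] and [r n.+1] are already
   known at time [n] and may serve in weights. *)
have ms' n m : (n <= m.+1)%N -> measurable_wrt (F m) (s n).
  move=> nm; apply: measurable_wrtD => //; first exact: measurable_wrt_cst.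
  apply: (measurable_wrt_psum (f := fun k x => h k x ^+ 2)) => k kn.
  apply: measurable_wrtX => //; apply: (measurable_wrtS _ (mh k)).
  by apply: Fmono; rewrite -ltnS; exact: leq_trans nm.
have mr n m : (n <= m.+1)%N -> measurable_wrt (F m) (r n).
  move=> nm; apply: measurable_wrt_inv_ge0 => //.
  rewrite (_ : (fun x => _) = fun x => s n x `^ 2^-1).
    by apply: measurable_wrt_powR => //; exact: ms'.
  by apply/funext => x; rewrite powR12_sqrt// (le_trans ler01).
have mM n : measurable_wrt (F n) (M n).
  apply: (measurable_wrt_psum (f := fun k x => h k x * e k x)) => k kn.
  apply: measurable_wrtM => //.
    by apply: (measurable_wrtS _ (mh k)); apply: Fmono; exact: ltnW.
  by apply: (measurable_wrtS _ (me k)); exact: Fmono.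
pose X n x := M n x ^+ 2 * r n x ^+ 3 + 2 * K * r n x.
have X0 n x : 0 <= X n x.
  rewrite /X; have := r0 n x => r0'.
  by rewrite addr_ge0// mulr_ge0 ?sqr_ge0 ?exprn_ge0 ?mulr_ge0// ltW.
have mX n : measurable_wrt (F n) (X n).
  apply: measurable_wrtD => //; apply: measurable_wrtM => //.
  - exact: measurable_wrtX.
  - by apply: measurable_wrtX => //; exact: mr.
  - exact: measurable_wrt_cst.
  - exact: mr.
have step n c A : F n A -> (forall x, A x -> X n x <= c) ->
     P.-integrable A (EFin \o X n.+1) /\
     \int[P]_(x in A) X n.+1 x <= \int[P]_(x in A) X n x.
  move=> FA Xc; have mA := Fm _ _ FA.
  (* The coefficients of [e n] and [e n ^ 2] in [M n.+1 ^ 2 * r n.+1 ^ 3]. *)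
  pose k1 x := 2 * (M n x * h n x) * r n.+1 x ^+ 3.
  pose k2 x := h n x ^+ 2 * r n.+1 x ^+ 3.
  have mr3 : measurable_wrt (F n) (fun x => r n.+1 x ^+ 3).
    by apply: measurable_wrtX => //; exact: mr.
  have mk1 : measurable_wrt (F n) k1.
    apply: measurable_wrtM => //; apply: measurable_wrtM => //.
      exact: measurable_wrt_cst.
    exact: measurable_wrtM.
  have mk2 : measurable_wrt (F n) k2.
    by apply: measurable_wrtM => //; exact: measurable_wrtX.
  have r30 x : 0 <= r n.+1 x ^+ 3 by rewrite exprn_ge0// ltW.
  have r3le x : r n.+1 x ^+ 3 <= r n x ^+ 3 by rewrite lerXn2r ?nnegrE// ltW.
  have Mr x : M n x ^+ 2 * r n.+1 x ^+ 3 <= M n x ^+ 2 * r n x ^+ 3.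
    by rewrite ler_wpM2l// sqr_ge0.
  have k2le x : 0 <= k2 x <= 2.
    rewrite mulr_ge0 ?sqr_ge0//=; apply: (le_trans (tele n x)).
    by have := r0 n.+1 x; have := r1 n x; lra.
  (* |2 M h| <= M ^ 2 + h ^ 2; after multiplication by [r n.+1 ^ 3] the two squares are at most [c]
     and 2. *)
  have k1le x : A x -> `|k1 x| <= c + 2.
    move=> Ax; have := Xc x Ax; rewrite /X.
    have : 0 <= 2 * K * r n x by rewrite !mulr_ge0// ltW.
    have := Mr x; have /andP[_] := k2le x; rewrite /k2 /k1 => h2 h3 h4 h5.
    have h6 : 0 <= (M n x - h n x) ^+ 2 * r n.+1 x ^+ 3 by rewrite mulr_ge0 ?sqr_ge0.
    have h7 : 0 <= (M n x + h n x) ^+ 2 * r n.+1 x ^+ 3 by rewrite mulr_ge0 ?sqr_ge0.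
    by rewrite ler_norml; apply/andP; split; lra.
  have m0 : measurable_wrt (F n) (fun=> (0:R)) by exact: measurable_wrt_cst.
  have max0 (z : R) : `|z| <= c + 2 -> 0 <= Num.max z 0 <= c + 2.
    by move=> z2; rewrite le_max lexx orbT ge_max (le_trans (ler_norm z) z2)
      (le_trans (normr_ge0 z) z2).
  (* [k1] has no sign while weights must be nonnegative: its positive part is paired with [e n] and
     its negative part with [- e n]. *)
  have W1 := weighted_drift (sF n) (Fm n) (de n) FA
    (measurable_wrt_max (sF n) mk1 m0) (fun x Ax => max0 _ (k1le x Ax)).
  have W2 := weighted_drift (sF n) (Fm n) (dNe n) FA
    (measurable_wrt_max (sF n) (measurable_wrtN (sF n) mk1) m0)
    (fun x Ax => max0 (- k1 x) (eq_ind_r (fun z => z <= c + 2) (k1le x Ax) (normrN _))).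
  have W3 := weighted_drift (sF n) (Fm n) (de2 n) FA mk2 (fun x _ => k2le x).
  have hD := drift_on_add mA (drift_on_add mA W1 W2) W3.
  (* The compensator [K * k2] of the quadratic term is paid for by the decrease of [2 * K * r n]. *)
  apply: (@dominated_drift (F n) A (X n) (X n.+1)
      (fun x => M n x ^+ 2 * r n.+1 x ^+ 3 + K * k2 x + 2 * K * r n.+1 x)
      (fun x => Num.max (k1 x) 0 * e n x + Num.max (- k1 x) 0 * - e n x
                + k2 x * (e n x ^+ 2 - K)) c) => //.
  - apply: measurable_wrtD => //; [apply: measurable_wrtD => //|];
      apply: measurable_wrtM => //.
    + exact: measurable_wrtX.
    + exact: measurable_wrt_cst.
    + exact: measurable_wrt_cst.
    + exact: mr.
  - exact: measurable_wrt_measurable (Fm _) (mX n.+1).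
  - move=> x Ax; have /andP[k20 _] := k2le x; have := Mr x.
    have := ler_wpM2l K0 (tele n x); rewrite -/(k2 x) /X => h1 h2.
    have : 0 <= M n x ^+ 2 * r n.+1 x ^+ 3 by rewrite mulr_ge0 ?sqr_ge0.
    have : 0 <= K * k2 x by rewrite mulr_ge0.
    have : 0 <= 2 * K * r n.+1 x by rewrite !mulr_ge0// ltW.
    by move=> h3 h4 h5; apply/andP; split; lra.
  - move=> x Ax; rewrite /X MS.
    have -> : Num.max (k1 x) 0 * e n x + Num.max (- k1 x) 0 * - e n x = k1 x * e n x.
      have [k|] := boolP (0 <= k1 x).
        by rewrite (max_l k) max_r ?oppr_le0// mul0r addr0.
      rewrite -ltNge => /ltW k; rewrite (max_r k) max_l ?oppr_ge0//.
      by rewrite mul0r add0r mulrNN.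
    by rewrite le_eqVlt; apply/orP; left; apply/eqP; rewrite /k1 /k2; ring.
  - exact: hD.1.
  - exact: hD.2.
have X0le x : X 0%N x <= 2 * K.
  by rewrite /X /M big_ord0 expr0n/= mul0r add0r ler_piMr// mulr_ge0.
apply: filterS (nneg_supermartingale_bounded hF mX X0 X0le step) => x [C XC].
exists C => n /=; rewrite -/(s n x) -/(M n x).
have : M n x ^+ 2 * r n x ^+ 3 <= C.
  by apply: le_trans (XC n); rewrite /X lerDl !mulr_ge0// ltW.
by rewrite /r exprVn ler_pdivrMr// exprn_gt0// sqrtr_gt0 (lt_le_trans ltr01).
Qed.

(** b ^ (1 + q) <= b because [b <= 1], and |z - K| <= max(z, K). Keeping the factor [b] to the first
    power is what lets the remainder telescope. *)
Lemma powR_centered_le (q b z K : R) : 0 < q -> 0 <= b -> b <= 1 -> 0 <= z ->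
  0 <= K -> `|b * (z - K)| `^ (1 + q) <= b * (z `^ (1 + q) + K `^ (1 + q)).
Proof.
move=> q0 b0 b1 z0 K0; rewrite normrM powRM// (ger0_norm b0).
apply: ler_pM; rewrite ?powR_ge0//.
  move: b0; rewrite le_eqVlt => /orP[/eqP <-|b0].
    by rewrite powR0// gt_eqF//; lra.
  by apply: ge1r_powR; rewrite ?b0//; lra.
have zp := powR_ge0 z (1 + q); have Kp := powR_ge0 K (1 + q).
have [zK|Kz] := leP z K.
  apply: (@le_trans _ _ (K `^ (1 + q))); last lra.
  apply: ge0_ler_powR; rewrite ?nnegrE//; first lra.
  by rewrite ler0_norm; lra.
apply: (@le_trans _ _ (z `^ (1 + q))); last lra.
apply: ge0_ler_powR; rewrite ?nnegrE//; first lra.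
by rewrite ger0_norm; lra.
Qed.

(* With [U_n] the centred sum and [q' = 1 + q], the process
   [max(U_n, 0) ^ q' / s_n ^ q' + C / s_n ^ q] is a nonnegative
   supermartingale. *)
Lemma weighted_sum_growth (b zeta : nat -> Omega -> R) (q K : R) :
  0 < q -> q <= 1 -> 0 <= K ->
  (forall n, measurable_wrt (F n.+1) (zeta n)) ->
  (forall n, measurable_wrt (F n) (b n)) ->
  (forall n x, 0 <= b n x <= 1) -> (forall n x, 0 <= zeta n x) ->
  (forall n, nonpos_drift P (F n) (fun x => zeta n x - K)) ->
  (forall n, nonpos_drift P (F n) (fun x => zeta n x `^ (1 + q) - K)) ->
  {ae P, forall x, exists C : R, forall n : nat,
    \sum_(k < n) b k x * zeta k x <= C * (1 + \sum_(k < n) b k x)}.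
Proof.
move=> q0 q1 K0 mz mb b01 z0 dz dzp.
have [sF Fm Fmono] := hF.
have b0 n x : 0 <= b n x by have /andP[] := b01 n x.
have b1 n x : b n x <= 1 by have /andP[] := b01 n x.
pose s n x := 1 + \sum_(k < n) b k x.
pose U n x := \sum_(k < n) b k x * (zeta k x - K).
(* Only an upper bound is sought, so the positive part of the centred sum is enough. *)
pose W n x := Num.max (U n x) 0.
pose r n x := s n x `^ (- (1 + q)).
pose t n x := s n x `^ (- q).
(* Bounds the conditional mean of [zeta n ^ (1 + q) + K ^ (1 + q)], the factor in the remainder of
   the power inequality. *)
pose L := K + K `^ (1 + q).
have L0 : 0 <= L by rewrite addr_ge0 ?powR_ge0.
have s1 n x : 1 <= s n x by rewrite lerDl sumr_ge0.
have s0 n x : 0 < s n x by apply: lt_le_trans (s1 n x).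
have sS n x : s n.+1 x = s n x + b n x by rewrite /s big_ord_recr/= addrA.
have US n x : U n.+1 x = U n x + b n x * (zeta n x - K) by rewrite /U big_ord_recr.
have W0 n x : 0 <= W n x by rewrite le_max lexx orbT.
have r0 n x : 0 <= r n x by exact: powR_ge0.
have t0 n x : 0 <= t n x by exact: powR_ge0.
have pow_le1 n x (p : R) : 0 <= p -> s n x `^ (- p) <= 1.
  move=> p0; rewrite powRN invf_le1 ?powR_gt0// -(powRr0 (s n x)).
  by rewrite ler_powR.
have r1 n x : r n x <= 1 by apply: pow_le1; lra.
have t1 n x : t n x <= 1 by apply: pow_le1; lra.
have rr n x : r n.+1 x <= r n x.
  rewrite /r !powRN lef_pV2 ?posrE ?powR_gt0//.
  by apply: ge0_ler_powR; rewrite ?nnegrE ?(ltW (s0 _ _))//; [lra|rewrite sS lerDl].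
have tele n x : q * (b n x * r n.+1 x) <= t n x - t n.+1 x.
  by rewrite /r /t sS; exact: powR_neg_telescope.
have ms n m : (n <= m.+1)%N -> measurable_wrt (F m) (s n).
  move=> nm; apply: measurable_wrtD => //; first exact: measurable_wrt_cst.
  apply: measurable_wrt_psum => k kn; apply: (measurable_wrtS _ (mb k)).
  by apply: Fmono; rewrite -ltnS; exact: leq_trans nm.
have mr n m : (n <= m.+1)%N -> measurable_wrt (F m) (r n).
  by move=> nm; apply: measurable_wrt_powR => //; exact: ms.
have mt n m : (n <= m.+1)%N -> measurable_wrt (F m) (t n).
  by move=> nm; apply: measurable_wrt_powR => //; exact: ms.
have mc n (c : R) : measurable_wrt (F n) (fun=> c) by exact: measurable_wrt_cst.
have mU n : measurable_wrt (F n) (U n).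
  apply: (measurable_wrt_psum (f := fun k x => b k x * (zeta k x - K))) => k kn.
  apply: measurable_wrtM => //.
    by apply: (measurable_wrtS _ (mb k)); apply: Fmono; exact: ltnW.
  apply: measurable_wrtB => //.
  by apply: (measurable_wrtS _ (mz k)); exact: Fmono.
have mW n : measurable_wrt (F n) (W n) by exact: measurable_wrt_max.
pose X n x := W n x `^ (1 + q) * r n x + 2 * L / q * t n x.
have Lq0 : 0 <= 2 * L / q by rewrite divr_ge0 ?mulr_ge0// ltW.
have X0 n x : 0 <= X n x by rewrite addr_ge0// mulr_ge0// powR_ge0.
have mX n : measurable_wrt (F n) (X n).
  apply: measurable_wrtD => //; apply: measurable_wrtM => //.
  - exact: measurable_wrt_powR.
  - exact: mr.
  - exact: mt.
have step n c A : F n A -> (forall x, A x -> X n x <= c) ->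
     P.-integrable A (EFin \o X n.+1) /\
     \int[P]_(x in A) X n.+1 x <= \int[P]_(x in A) X n x.
  move=> FA Xc; have mA := Fm _ _ FA.
  pose k1 x := (1 + q) * W n x `^ q * b n x * r n.+1 x.
  pose k2 x := 2 * b n x * r n.+1 x.
  have mr' := mr n.+1 n (leqnn _).
  have mk1 : measurable_wrt (F n) k1.
    do 3![apply: measurable_wrtM => //]; exact: measurable_wrt_powR.
  have mk2 : measurable_wrt (F n) k2 by do 2![apply: measurable_wrtM => //].
  have br x : 0 <= b n x * r n.+1 x <= 1.
    by rewrite mulr_ge0//= mulr_ile1.
  have k2le x : 0 <= k2 x <= 2.
    by have /andP[? ?] := br x; rewrite /k2 -mulrA; apply/andP; split; lra.
  have Wr x : 0 <= W n x `^ (1 + q) * r n.+1 x <= W n x `^ (1 + q) * r n x.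
    by rewrite mulr_ge0 ?powR_ge0//= ler_wpM2l ?powR_ge0.
  (* W ^ q <= 1 + W ^ (1 + q), and [X n <= c] controls the larger power once it is multiplied by
     [r n.+1]. *)
  have k1le x : A x -> 0 <= k1 x <= 2 * (1 + c).
    move=> Ax; have Wq := powR_ge0 (W n x) q; have Wp := powR_ge0 (W n x) (1 + q).
    rewrite /k1 -!mulrA mulr_ge0 ?mulr_ge0//=; last lra.
    have h1 : W n x `^ q <= 1 + W n x `^ (1 + q).
      have [W1|/ltW W1] := leP (W n x) 1.
        have : W n x `^ q <= 1 `^ q by apply: ge0_ler_powR; rewrite ?nnegrE// ltW.
        by rewrite powR1; lra.
      have : W n x `^ q <= W n x `^ (1 + q) by apply: ler_powR => //; lra.
      by lra.
    have h2 : W n x `^ (1 + q) * r n.+1 x <= c.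
      apply: le_trans (Xc x Ax); have /andP[_ /le_trans] := Wr x; apply.
      by rewrite /X lerDl mulr_ge0.
    have h3 : W n x `^ q * (b n x * r n.+1 x) <= (1 + W n x `^ (1 + q)) * r n.+1 x.
      apply: ler_pM => //; first by have /andP[] := br x.
      by rewrite ler_piMl.
    have h4 : 0 <= W n x `^ q * (b n x * r n.+1 x) by rewrite !mulr_ge0.
    have h5 := r1 n.+1 x.
    by apply: ler_pM => //; [lra|lra|lra].
  have W1 := weighted_drift (sF n) (Fm n) (dz n) FA mk1 k1le.
  have W2 := weighted_drift (sF n) (Fm n) (dzp n) FA mk2 (fun x _ => k2le x).
  have hD := drift_on_add mA W1 W2.
  apply: (@dominated_drift (F n) A (X n) (X n.+1)
      (fun x => W n x `^ (1 + q) * r n.+1 x + k2 x * L + 2 * L / q * t n.+1 x)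
      (fun x => k1 x * (zeta n x - K) + k2 x * (zeta n x `^ (1 + q) - K)) c) => //.
  - apply: measurable_wrtD => //; [apply: measurable_wrtD => //|];
      apply: measurable_wrtM => //.
    + exact: measurable_wrt_powR.
    + exact: mt.
  - exact: measurable_wrt_measurable (Fm _) (mX n.+1).
  - move=> x Ax; have /andP[k20 _] := k2le x; have /andP[h1 h2] := Wr x.
    have h3 := ler_wpM2l Lq0 (tele n x).
    have h4 : 2 * L / q * (q * (b n x * r n.+1 x)) = k2 x * L.
      by rewrite /k2; field; rewrite gt_eqF.
    rewrite h4 in h3.
    have h5 : 0 <= k2 x * L by rewrite mulr_ge0.
    have h6 : 0 <= 2 * L / q * t n.+1 x by rewrite mulr_ge0.
    by apply/andP; rewrite /X; split; lra.
  - move=> x Ax.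
    have h1 := powR_pos_part_le (U n x) (b n x * (zeta n x - K)) q0 q1.
    rewrite -US -/(W n x) -/(W n.+1 x) in h1.
    have h2 := powR_centered_le q0 (b0 n x) (b1 n x) (z0 n x) K0.
    have h3 := ler_wpM2r (r0 n.+1 x) h1.
    have h4 := ler_wpM2r (r0 n.+1 x) h2.
    by rewrite /X /k1 /k2 /L; lra.
  - exact: hD.1.
  - exact: hD.2.
have X0le x : X 0%N x <= 2 * L / q.
  rewrite /X /W /U big_ord0 max_l// powR0 ?mul0r ?add0r; first by rewrite ler_piMr.
  by rewrite gt_eqF//; lra.
apply: filterS (nneg_supermartingale_bounded hF mX X0 X0le step) => x [C XC].
have C0 : 0 <= C by apply: le_trans (XC 0%N).
(* [1 + C] bounds the centred sum relative to [s n], and [K] accounts for the centring. *)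
exists (1 + C + K) => n; rewrite -/(s n x).
have h1 : W n x `^ (1 + q) <= C * s n x `^ (1 + q).
  rewrite -ler_pdivrMr ?powR_gt0// -powRN; apply: le_trans (XC n).
  by rewrite /X lerDl mulr_ge0.
(* Extracts the root of order 1 + q, using C <= 1 + C <= (1 + C) ^ (1 + q). *)
have h2 : W n x <= (1 + C) * s n x.
  rewrite leNgt; apply/negP => lt.
  have : ((1 + C) * s n x) `^ (1 + q) < W n x `^ (1 + q).
    apply: gt0_ltr_powR; rewrite ?nnegrE ?mulr_ge0// ?(ltW (s0 _ _))//; lra.
  apply/negP; rewrite -leNgt (le_trans h1)// powRM ?(ltW (s0 _ _))//; last lra.
  rewrite ler_wpM2r ?powR_ge0//; apply: (@le_trans _ _ (1 + C)); first lra.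
  by apply: le1r_powR; lra.
have h3 : \sum_(k < n) b k x * zeta k x = U n x + K * \sum_(k < n) b k x.
  rewrite mulr_sumr -big_split/=; apply: eq_bigr => k _; ring.
have h4 : U n x <= W n x by rewrite le_max lexx.
rewrite h3; move: h2; rewrite /s; have : 0 <= \sum_(k < n) b k x by rewrite sumr_ge0.
lra.
Qed.

End Growth.

(** * Quadratic forms and rank-one updates *)

Section QuadraticForms.
Context (R : realType).
Implicit Types (r : nat).

Definition dotv r (u v : 'cV[R]_r) : R := (u^T *m v) 0 0.

Lemma dotvE r (u v : 'cV[R]_r) : dotv u v = \sum_i u i 0 * v i 0.
Proof. by rewrite /dotv mxE; apply: eq_bigr => i _; rewrite mxE. Qed.

Lemma dotvC r (u v : 'cV[R]_r) : dotv u v = dotv v u.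
Proof. by rewrite !dotvE; apply: eq_bigr => i _; rewrite mulrC. Qed.

Lemma dotvDr r (u v w : 'cV[R]_r) : dotv u (v + w) = dotv u v + dotv u w.
Proof. by rewrite /dotv mulmxDr mxE. Qed.

Lemma dotvZr r (c : R) (u v : 'cV[R]_r) : dotv u (c *: v) = c * dotv u v.
Proof. by rewrite /dotv -scalemxAr mxE. Qed.

Lemma dotvDl r (u v w : 'cV[R]_r) : dotv (u + v) w = dotv u w + dotv v w.
Proof. by rewrite dotvC dotvDr !(dotvC w). Qed.

Lemma dotvZl r (c : R) (u v : 'cV[R]_r) : dotv (c *: u) v = c * dotv u v.
Proof. by rewrite dotvC dotvZr (dotvC v). Qed.

Lemma dotv_adj r (A : 'M[R]_r) (u v : 'cV[R]_r) :
  dotv u (A *m v) = dotv (A^T *m u) v.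
Proof. by rewrite /dotv trmx_mul trmxK mulmxA. Qed.

Lemma dotv_qf r (A : 'M[R]_r) (u : 'cV[R]_r) :
  (u^T *m A *m u) 0 0 = dotv u (A *m u).
Proof. by rewrite /dotv mulmxA. Qed.

Lemma outer_mulmx r (u v z : 'cV[R]_r) : u *m v^T *m z = dotv v z *: u.
Proof.
rewrite -mulmxA [v^T *m z]mx11_scalar -/(dotv v z).
by rewrite mul_mx_scalar.
Qed.

Lemma norm2_sqr r (v : 'cV[R]_r) : norm2 v ^+ 2 = dotv v v.
Proof.
rewrite /norm2 sqr_sqrtr; last by apply: sumr_ge0 => i _; exact: sqr_ge0.
by rewrite dotvE; apply: eq_bigr => i _; rewrite expr2.
Qed.

Lemma sqr_le_dotvv r (v : 'cV[R]_r) (i : 'I_r) : v i 0 ^+ 2 <= dotv v v.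
Proof.
rewrite dotvE (bigD1 i)//= -expr2 lerDl sumr_ge0// => j _.
by rewrite -expr2 sqr_ge0.
Qed.

Lemma dotvv_ge0 r (v : 'cV[R]_r) : 0 <= dotv v v.
Proof. by rewrite dotvE sumr_ge0// => j _; rewrite -expr2 sqr_ge0. Qed.

Lemma dotvv_gt0 r (v : 'cV[R]_r) : v != 0 -> 0 < dotv v v.
Proof.
move=> v0; rewrite lt_def dotvv_ge0 andbT; apply: contra v0 => /eqP h.
apply/eqP/matrixP => i j; rewrite ord1 mxE; have := sqr_le_dotvv v i.
rewrite h => h2; apply/eqP; rewrite -sqrf_eq0 eq_le h2 sqr_ge0//.
Qed.

Lemma posdefmxP r (A : 'M[R]_r) (x : 'cV[R]_r) : posdefmx A -> x != 0 ->
  0 < dotv x (A *m x).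
Proof. by move=> [_ pA] /pA; rewrite dotv_qf. Qed.

Lemma posdefmx_ge0 r (A : 'M[R]_r) (x : 'cV[R]_r) : posdefmx A ->
  0 <= dotv x (A *m x).
Proof.
move=> pA; have [->|x0] := eqVneq x 0; first by rewrite mulmx0 /dotv mulmx0 mxE.
exact/ltW/posdefmxP.
Qed.

Lemma not_unitmxP r (A : 'M[R]_r) : A \notin unitmx ->
  exists2 v : 'rV[R]_r, v != 0 & v *m A = 0.
Proof.
rewrite -row_free_unit -kermx_eq0 => /rowV0Pn[v /sub_kermxP vA v0].
by exists v.
Qed.

Lemma posdefmx_unit r (A : 'M[R]_r) : posdefmx A -> A \in unitmx.
Proof.
move=> pA; apply: contraT => /not_unitmxP[v v0 vA].
have vT0 : v^T != 0 by apply: contra v0 => /eqP h; rewrite -[v]trmxK h trmx0.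
by have := posdefmxP pA vT0; rewrite -dotv_qf trmxK vA mul0mx mxE ltxx.
Qed.

Lemma posdefmx_inv r (A : 'M[R]_r) : posdefmx A -> posdefmx (invmx A).
Proof.
move=> pA; have uA := posdefmx_unit pA; have [sA _] := pA; split.
  by rewrite trmx_inv sA.
move=> x x0; rewrite dotv_qf.
have Ax0 : invmx A *m x != 0.
  by apply: contra x0 => /eqP h; rewrite -[x](mulKVmx uA) h mulmx0.
by have := posdefmxP pA Ax0; rewrite mulKVmx// dotvC.
Qed.

Lemma posdefmx_rank1_update r (A : 'M[R]_r) (v : 'cV[R]_r) : posdefmx A ->
  posdefmx (A + v *m v^T).
Proof.
move=> pA; have [sA _] := pA; split.
  by rewrite linearD/= sA trmx_mul trmxK.
move=> x x0; rewrite dotv_qf mulmxDl outer_mulmx dotvDr dotvZr (dotvC x v).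
by rewrite ltr_wpDr ?posdefmxP// -expr2 sqr_ge0.
Qed.

Lemma psd_cauchy_schwarz r (B : 'M[R]_r) (x y : 'cV[R]_r) : B^T = B ->
  (forall z, 0 <= dotv z (B *m z)) ->
  dotv x (B *m y) ^+ 2 <= dotv x (B *m x) * dotv y (B *m y).
Proof.
move=> sB pB.
set a := dotv x (B *m x); set b := dotv x (B *m y); set c := dotv y (B *m y).
have byx : dotv y (B *m x) = b by rewrite dotv_adj sB dotvC.
have h t s : 0 <= t ^+ 2 * a + 2 * t * s * b + s ^+ 2 * c.
  have := pB (t *: x + s *: y).
  rewrite mulmxDr -!scalemxAr !dotvDl !dotvDr !dotvZl !dotvZr -/a -/b -/c byx.
  by move=> /le_trans; apply; rewrite le_eqVlt; apply/orP; left; apply/eqP; ring.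
have a0 : 0 <= a by exact: pB.
have c0 : 0 <= c by exact: pB.
have [c_gt0|c_le0] := ltP 0 c.
  have := h c (- b).
  rewrite (_ : _ + _ = c * (a * c - b ^+ 2)); last by ring.
  by rewrite pmulr_rge0// subr_ge0.
have cE : c = 0 by lra.
have [b0|b_neq0] := eqVneq b 0; first by rewrite b0 expr0n/= mulr_ge0.
have b2 : 0 < b ^+ 2 by rewrite lt_def sqrf_eq0 b_neq0 sqr_ge0.
(* For c = 0 this choice gives the value - b ^ 2 (a + 2), negative unless b = 0. *)
have := h b (- (a + 1)); rewrite cE mulr0; have := mulr_ge0 (ltW b2) a0; lra.
Qed.

(** The coordinates of a unit vector have modulus at most 1, so the sum of the moduli of the entries
    is a bound. *)
Lemma qf_bounded r (M : 'M[R]_r) : exists2 C : R, 0 < C &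
  forall x : 'cV[R]_r, dotv x x = 1 -> dotv x (M *m x) <= C.
Proof.
exists (1 + \sum_i \sum_j `|M i j|).
  by rewrite ltr_pwDl// sumr_ge0// => i _; rewrite sumr_ge0.
move=> x x1; have xle i : `|x i 0| <= 1.
  have := sqr_le_dotvv x i; rewrite x1 -real_normK ?num_real// => h.
  by rewrite -(@ler_pXn2r _ 2)// ?nnegrE// expr1n.
apply: (@le_trans _ _ (\sum_i \sum_j `|M i j|)); last by rewrite lerDr.
rewrite dotvE; apply: ler_sum => i _.
apply: (le_trans (ler_norm _)); rewrite normrM.
apply: (@le_trans _ _ `|(M *m x) i 0|); first by rewrite ler_piMl.
rewrite mxE; apply: (le_trans (ler_norm_sum _ _ _)); apply: ler_sum => j _.
by rewrite normrM ler_piMr.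
Qed.

(** The infimum [mu] of the form over the unit sphere is shown to be an eigenvalue without
    compactness: it suffices that [A - mu%:M] is singular. No eigenvalue is smaller, since each is a
    Rayleigh quotient, and an eigenvector for [mu] shows [mu > 0]. *)
Lemma lambda_min_posdef r (A : 'M[R]_r) : posdefmx A -> (0 < r)%N ->
  0 < lambda_min A /\
  forall x : 'cV[R]_r, lambda_min A * dotv x x <= dotv x (A *m x).
Proof.
move=> pA r0; have [sA _] := pA.
pose S := [set dotv x (A *m x) | x in [set x : 'cV[R]_r | dotv x x = 1]].
have S0 : S !=set0.
  exists (dotv (delta_mx (Ordinal r0) 0) (A *m delta_mx (Ordinal r0) 0)).
  exists (delta_mx (Ordinal r0) 0) => //=.
  rewrite dotvE (bigD1 (Ordinal r0))//= !mxE !eqxx mulr1 big1 ?addr0// => i iN.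
  by rewrite !mxE (negbTE iN) mul0r.
have lbS : lbound S 0 by move=> _ [x _ <-]; exact: posdefmx_ge0.
have hlS : has_lbound S by exists 0.
pose mu := inf S.
have muP x : mu * dotv x x <= dotv x (A *m x).
  have [->|x0] := eqVneq x 0; first by rewrite mulmx0 /dotv mulmx0 mxE mulr0.
  have xx := dotvv_gt0 x0.
  rewrite -ler_pdivlMr//; apply: ge_inf => //.
  exists ((Num.sqrt (dotv x x))^-1 *: x) => /=.
    rewrite dotvZl dotvZr mulrA -expr2 exprVn sqr_sqrtr ?(ltW xx)//.
    by rewrite mulVf// gt_eqF.
  rewrite -scalemxAr dotvZl dotvZr mulrA -expr2 exprVn sqr_sqrtr ?(ltW xx)//.
  by rewrite mulrC.
pose B := A - mu%:M.
have Bx x : B *m x = A *m x - mu *: x by rewrite mulmxBl mul_scalar_mx.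
have qfB x : dotv x (B *m x) = dotv x (A *m x) - mu * dotv x x.
  by rewrite Bx dotvDr -scaleNr dotvZr mulNr.
have sB : B^T = B by rewrite /B linearB/= sA tr_scalar_mx.
have pB x : 0 <= dotv x (B *m x) by rewrite qfB subr_ge0.
(* Were [B] invertible, Cauchy-Schwarz for its form at x and the inverse image of x would keep the
   form at least [C^-1] on the sphere, so the infimum would be at least [mu + C^-1]. *)
have nB : B \notin unitmx.
  apply/negP => uB; have [C C0 hC] := qf_bounded (invmx B).
  have : mu + C^-1 <= mu; last by rewrite gerDl leNgt invr_gt0 C0.
  apply: lb_le_inf => // _ [x x1 <-].
  have := psd_cauchy_schwarz x (invmx B *m x) sB pB.
  rewrite mulKVmx// x1 expr1n (dotvC _ x) => h.
  have : 1 <= dotv x (B *m x) * C.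
    by apply: (le_trans h); rewrite ler_wpM2l// hC.
  by rewrite -ler_pdivrMr// div1r qfB x1 mulr1 lerBrDl.
have [v v0 vB] := not_unitmxP nB.
have vA : v *m A = mu *: v.
  by apply/eqP; rewrite -subr_eq0 -mul_mx_scalar -mulmxBr vB.
have eigP a : eigenvalue A a -> exists2 x : 'cV[R]_r, x != 0 &
    dotv x (A *m x) = a * dotv x x.
  move=> /eigenvalueP[u uA u0]; exists u^T.
    by apply: contra u0 => /eqP h; rewrite -[u]trmxK h trmx0.
  by rewrite -dotv_qf trmxK uA -scalemxAl mxE /dotv trmxK.
have muE : eigenvalue A mu by apply/eigenvalueP; exists v.
have lbE : lbound [set a : R | eigenvalue A a] mu.
  move=> a /= /eigP[x x0 xA]; have := muP x; rewrite xA.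
  by rewrite ler_pM2r// dotvv_gt0.
have -> : lambda_min A = mu.
  apply/eqP; rewrite eq_le; apply/andP; split.
    by apply: ge_inf => //; exists mu.
  by apply: lb_le_inf => //; exists mu.
split=> //; have [x x0 xA] := eigP _ muE.
by have := posdefmxP pA x0; rewrite xA pmulr_lgt0// dotvv_gt0.
Qed.

Lemma det_le r (A : 'M[R]_r) (c : R) : 0 <= c -> (forall i j, `|A i j| <= c) ->
  `|\det A| <= r`!%:R * c ^+ r.
Proof.
move=> c0 Ac; rewrite /determinant; apply: (le_trans (ler_norm_sum _ _ _)).
apply: (@le_trans _ _ (\sum_(s : 'S_r) c ^+ r)).
  apply: ler_sum => s _; rewrite normrM normrX normrN1 expr1n mul1r normr_prod.
  have -> : c ^+ r = \prod_(i < r) c by rewrite prodr_const card_ord.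
  by apply: ler_prod => i _; rewrite normr_ge0 Ac.
by rewrite sumr_const card_Sn mulr_natl.
Qed.

(** The two sides are the determinant of one bordered matrix, computed from its two block triangular
    factorizations. *)
Lemma det_rank1_update r (Q : 'M[R]_r) (v : 'cV[R]_r) : Q \in unitmx ->
  \det (Q + v *m v^T) = (1 + dotv v (invmx Q *m v)) * \det Q.
Proof.
move=> uQ; set g := invmx Q *m v.
pose B : 'M[R]_(1 + r) := block_mx 1%:M (- v^T) v Q.
have B1 : B = block_mx 1%:M 0 v 1%:M *m block_mx 1%:M (- v^T) 0 (Q + v *m v^T).
  rewrite mulmx_block !mul1mx !mulmx1 !mulmx0 !mul0mx !addr0 mulmxN.
  by rewrite addrC addrK.
have B2 : B = block_mx (1 + dotv v g)%:M (- v^T) 0 Q *m block_mx 1%:M 0 g 1%:M.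
  rewrite mulmx_block !mulmx1 !mulmx0 !add0r mulKVmx//.
  by rewrite mulNmx [v^T *m g]mx11_scalar -/(dotv v g) raddfD/= addrK.
have d1 : \det B = \det (Q + v *m v^T).
  by rewrite B1 det_mulmx det_lblock det_ublock !det1 !mul1r.
rewrite -d1 B2 det_mulmx det_lblock det_ublock !det1 !mulr1 det_scalar expr1.
by [].
Qed.

Lemma sherman_morrison r (Q : 'M[R]_r) (v : 'cV[R]_r) :
  Q \in unitmx -> Q + v *m v^T \in unitmx -> 1 + dotv v (invmx Q *m v) != 0 ->
  invmx (Q + v *m v^T) =
  invmx Q - (1 + dotv v (invmx Q *m v))^-1 *:
    (invmx Q *m v *m v^T *m invmx Q).
Proof.
move=> uQ uQ' c0; set P := invmx Q; set c := dotv v (P *m v) in c0 *.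
apply: (@can_inj _ _ _ _ (mulKmx uQ')); rewrite mulmxV//.
rewrite mulmxBr -scalemxAr !mulmxDl !mulmxA mulmxV// mul1mx.
have -> : v *m v^T *m P *m v *m v^T *m P = c *: (v *m v^T *m P).
  by rewrite -(mulmxA (v *m v^T) P v) outer_mulmx -/c -!scalemxAl.
rewrite -[X in X + c *: _]scale1r -scalerDl scalerA mulVf// scale1r.
by rewrite addrK.
Qed.

(** For the gain direction [g] the product of g with Q z is [u], so the updated form depends only on
    [u], [w], the old form and c = 1 / a - 1; the rest is scalar algebra. *)
Lemma lyapunov_step r (Q : 'M[R]_r) (v z : 'cV[R]_r) (w : R) :
  posdefmx Q ->
  let g := invmx Q *m v in
  let a := (1 + dotv v g)^-1 in
  let u := dotv v z in
  let z' := z + (a * (w - u)) *: g in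
  dotv z' ((Q + v *m v^T) *m z') =
  dotv z (Q *m z) - a * u ^+ 2 + 2 * a * u * w + (1 - a) * w ^+ 2.
Proof.
move=> pQ g a u z'; have uQ := posdefmx_unit pQ; have [sQ _] := pQ.
pose t := a * (w - u); pose c := dotv v g.
have c0 : 0 <= c by exact: posdefmx_ge0 (posdefmx_inv pQ).
have c1 : 1 + c != 0 by rewrite gt_eqF// ltr_wpDr.
have gz : dotv g (Q *m z) = u by rewrite dotv_adj sQ /g mulKVmx.
have -> : (Q + v *m v^T) *m z' = Q *m z + (t + u + t * c) *: v.
  rewrite mulmxDl outer_mulmx /z' mulmxDr -scalemxAr mulKVmx//.
  by rewrite dotvDr dotvZr -/u -/c -/t -addrA -scalerDl addrA.
rewrite /z' dotvDl dotvZl !dotvDr !dotvZr gz (dotvC z v) (dotvC g v) -/u -/c -/t.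
by rewrite /t /a -/c; field.
Qed.

End QuadraticForms.

(** * The recursive least squares recursion along a path *)

Section RLSPath.
Context (R : realType) (r : nat).
Variables (P0 : 'M[R]_r) (theta0 theta : 'cV[R]_r).
Variables (phi : nat -> 'cV[R]_r) (y w : nat -> R).
Hypothesis hP0 : posdefmx P0.
Hypothesis hy : forall k, y k.+1 = dotv (phi k) theta + w k.+1.

(** Q_k of the overview; [reg_lambda_min] at [n] is the smallest eigenvalue of [info_mx n.+1]. *)
Definition info_mx (k : nat) : 'M[R]_r :=
  invmx P0 + \sum_(j < k) phi j *m (phi j)^T.

Definition rls_coef (k : nat) : R := rls_gain (rls_P P0 phi k) (phi k).

Definition rls_err (k : nat) : 'cV[R]_r := rls_theta P0 theta0 phi y k - theta.

Definition pred_err (k : nat) : R := dotv (phi k) (rls_err k).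

Definition lyapunov (k : nat) : R := dotv (rls_err k) (info_mx k *m rls_err k).

Lemma info_mxS k : info_mx k.+1 = info_mx k + phi k *m (phi k)^T.
Proof. by rewrite /info_mx big_ord_recr/= addrA. Qed.

Lemma info_mx_posdef k : posdefmx (info_mx k).
Proof.
elim: k => [|k IH]; last by rewrite info_mxS; exact: posdefmx_rank1_update.
by rewrite /info_mx big_ord0 addr0; exact: posdefmx_inv.
Qed.

Lemma rls_gain_dotv (M : 'M[R]_r) v : rls_gain M v = (1 + dotv v (M *m v))^-1.
Proof. by rewrite /rls_gain dotv_qf. Qed.

(** The recursion for P_k is the Sherman-Morrison formula for the inverse of the information
    matrix. *)
Lemma rls_P_info k : rls_P P0 phi k = invmx (info_mx k).
Proof.
elim: k => [|k IH]; first by rewrite /= /info_mx big_ord0 addr0 invmxK.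
have pQ := info_mx_posdef k; have pQ' := info_mx_posdef k.+1.
rewrite /= IH info_mxS sherman_morrison.
- by rewrite rls_gain_dotv.
- exact: posdefmx_unit.
- by rewrite -info_mxS; exact: posdefmx_unit.
- rewrite gt_eqF// ltr_wpDr// posdefmx_ge0//; exact: posdefmx_inv.
Qed.

Lemma rls_coefE k :
  rls_coef k = (1 + dotv (phi k) (invmx (info_mx k) *m phi k))^-1.
Proof. by rewrite /rls_coef rls_gain_dotv rls_P_info. Qed.

Lemma rls_coef_bounds k : 0 < rls_coef k <= 1.
Proof.
rewrite rls_coefE; set c := dotv _ _.
have c0 : 0 <= c by apply: posdefmx_ge0; apply: posdefmx_inv; exact: info_mx_posdef.
by rewrite invr_gt0 ltr_wpDr//= invf_le1 ?ltr_wpDr// lerDl.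
Qed.

Lemma rls_errS k : rls_err k.+1 = rls_err k +
  (rls_coef k * (w k.+1 - pred_err k)) *: (invmx (info_mx k) *m phi k).
Proof.
rewrite /rls_err /= rls_P_info addrAC; congr (_ + _ *: _).
rewrite /rls_coef rls_P_info; congr (_ * _).
rewrite hy -/(dotv (phi k) _) /pred_err /rls_err dotvDr -(scaleN1r theta) dotvZr; ring.
Qed.

Lemma lyapunovS k : lyapunov k.+1 = lyapunov k
  - rls_coef k * pred_err k ^+ 2 + 2 * rls_coef k * pred_err k * w k.+1
  + (1 - rls_coef k) * w k.+1 ^+ 2.
Proof.
rewrite /lyapunov rls_errS info_mxS {1 2}rls_coefE.
by rewrite lyapunov_step ?rls_coefE//; exact: info_mx_posdef.
Qed.

(** The sums start after the first step because the conditional assumptions concern [w k.+1] for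
    [k >= 1]; the effect of [w 1] sits in [lyapunov 1]. *)
Lemma lyapunov_sum n : lyapunov n.+1 = lyapunov 1
  - \sum_(k < n) rls_coef k.+1 * pred_err k.+1 ^+ 2
  + \sum_(k < n) 2 * rls_coef k.+1 * pred_err k.+1 * w k.+2
  + \sum_(k < n) (1 - rls_coef k.+1) * w k.+2 ^+ 2.
Proof.
elim: n => [|n IH]; first by rewrite !big_ord0; ring.
by rewrite lyapunovS IH !big_ord_recr /=; ring.
Qed.

Lemma det_info_mxS k :
  \det (info_mx k.+1) = (rls_coef k)^-1 * \det (info_mx k).
Proof.
rewrite info_mxS det_rank1_update ?rls_coefE ?invrK//.
exact: posdefmx_unit (info_mx_posdef k).
Qed.

Lemma det_info_mx_gt0 k : 0 < `|\det (info_mx k)|.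
Proof.
by rewrite normr_gt0 -unitfE -[_ \is a _]/(info_mx k \in unitmx)
  (posdefmx_unit (info_mx_posdef k)).
Qed.

(* [1 - a <= - ln a], and [1 / a_k] is the ratio of consecutive determinants. *)
Lemma sum_leverage_le_ln_det n : \sum_(k < n) (1 - rls_coef k) <=
  ln `|\det (info_mx n)| - ln `|\det (info_mx 0)|.
Proof.
elim: n => [|n IH]; first by rewrite big_ord0 subrr.
rewrite big_ord_recr/= det_info_mxS normrM.
have /andP[a0 a1] := rls_coef_bounds n.
have ai : 0 < (rls_coef n)^-1 by rewrite invr_gt0.
rewrite (gtr0_norm ai) lnM ?posrE ?det_info_mx_gt0// lnV ?posrE//.
have := @le_ln1Dx R (rls_coef n - 1) ltac:(lra).
rewrite (_ : 1 + (rls_coef n - 1) = rls_coef n); [lra|ring].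
Qed.

Lemma regR_ge1 n : 1 <= regR phi n.
Proof. by rewrite lerDl sumr_ge0// => k _; exact: sqr_ge0. Qed.

Lemma regR_mono n m : (n <= m)%N -> regR phi n <= regR phi m.
Proof.
move=> nm; rewrite lerD2l -!(big_mkord xpredT (fun k => norm2 (phi k) ^+ 2)).
rewrite (@big_cat_nat _ _ _ n.+1 0 m.+1)//= lerDl sumr_ge0// => k _.
exact: sqr_ge0.
Qed.

Lemma info_mx_entry_le : exists2 c : R, 0 <= c &
  forall n i j, `|info_mx n.+1 i j| <= (c + 1) * regR phi n.
Proof.
exists (\sum_i \sum_j `|invmx P0 i j|).
  by rewrite sumr_ge0// => i _; rewrite sumr_ge0.
move=> n i j; rewrite /info_mx mxE.
set c := \sum_i _; apply: (le_trans (ler_normD _ _)).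
have h1 : `|invmx P0 i j| <= c.
  rewrite /c (bigD1 i)//= (bigD1 j)//= -addrA lerDl addr_ge0 ?sumr_ge0//.
  by move=> k _; rewrite sumr_ge0.
have h2 : `|(\sum_(k < n.+1) phi k *m (phi k)^T) i j| <= regR phi n.
  rewrite summxE; apply: (le_trans (ler_norm_sum _ _ _)).
  apply: (@le_trans _ _ (\sum_(k < n.+1) norm2 (phi k) ^+ 2)); last by rewrite lerDr.
  apply: ler_sum => k _; rewrite norm2_sqr mxE big_ord1 mxE normrM.
  have := sqr_le_dotvv (phi k) i; have := sqr_le_dotvv (phi k) j.
  rewrite -[_ i 0 ^+ 2]real_normK ?num_real// -[_ j 0 ^+ 2]real_normK ?num_real//.
  (* Gives |a b| <= (a ^ 2 + b ^ 2) / 2, and each square is at most the squared norm. *)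
  have := sqr_ge0 (`|phi k i 0| - `|phi k j 0|).
  by lra.
have c0 : 0 <= c by apply: le_trans h1.
have := ler_wpM2l c0 (regR_ge1 n); lra.
Qed.

(** The entries grow at most linearly in R_n, so the determinant grows at most like R_n ^ r, and the
    logarithm brings out the factor [r]. *)
Lemma sum_leverage_le_ln_regR : exists C : R,
  forall n, \sum_(k < n.+1) (1 - rls_coef k) <= C + r%:R * ln (regR phi n).
Proof.
have [c c0 hc] := info_mx_entry_le.
exists (ln (r`!%:R * (c + 1) ^+ r) - ln `|\det (info_mx 0)|) => n.
apply: (le_trans (sum_leverage_le_ln_det _)).
have R0 : 0 < regR phi n by apply: lt_le_trans (regR_ge1 n).
have c1 : 0 < c + 1 by lra.
have f0 : 0 < (r`!%:R : R) by rewrite ltr0n fact_gt0.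
rewrite addrAC lerD2r.
have -> : ln (r`!%:R * (c + 1) ^+ r) + r%:R * ln (regR phi n) =
    ln (r`!%:R * ((c + 1) * regR phi n) ^+ r).
  rewrite !lnM ?posrE ?exprn_gt0 ?mulr_gt0// !lnXn ?mulr_gt0// lnM ?posrE//.
  by rewrite mulr_natl -addrA -mulrnDl.
rewrite ler_ln ?posrE ?det_info_mx_gt0 ?mulr_gt0 ?exprn_gt0 ?mulr_gt0//.
by apply: det_le => //; rewrite mulr_ge0// ltW.
Qed.

(** The square of the right side dominates C s ^ 3 because s ^ 2 (s - 8 C) ^ 2 >= 0. The coefficient
    1 / 4 is small enough for the term in s ^ 2 to be absorbed by the negative part of the Lyapunov
    sum. *)
Lemma martingale_part_le (C M s : R) : 0 <= s -> M ^+ 2 <= C * s ^+ 3 ->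
  M <= s ^+ 2 / 4 + 8 * C ^+ 2.
Proof.
move=> s0 MC; rewrite leNgt; apply/negP => lt.
have D0 : 0 <= s ^+ 2 / 4 + 8 * C ^+ 2 by have := sqr_ge0 s; have := sqr_ge0 C; lra.
have : (s ^+ 2 / 4 + 8 * C ^+ 2) ^+ 2 < M ^+ 2.
  by rewrite ltrXn2r// ?nnegrE// (le_trans D0 (ltW lt)).
have : 0 <= s ^+ 2 * (s - 8 * C) ^+ 2 by rewrite mulr_ge0 ?sqr_ge0.
have : 0 <= (8 * C ^+ 2) ^+ 2 by exact: sqr_ge0.
nra.
Qed.

Lemma lyapunov_growth :
  (exists C : R, forall n : nat,
    let h k := 2 * rls_coef k.+1 * pred_err k.+1 in
    (\sum_(k < n) h k * w k.+2) ^+ 2 <=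
      C * Num.sqrt (1 + \sum_(k < n) h k ^+ 2) ^+ 3) ->
  (exists C : R, forall n : nat,
    \sum_(k < n) (1 - rls_coef k.+1) * w k.+2 ^+ 2 <=
      C * (1 + \sum_(k < n) (1 - rls_coef k.+1))) ->
  exists C : R, forall n, lyapunov n.+1 <= C * (1 + ln (regR phi n)).
Proof.
move=> [C1 h1] [C2 h2]; have [C3 h3] := sum_leverage_le_ln_regR.
pose D := `|lyapunov 1| + 1 / 4 + 8 * C1 ^+ 2.
exists (D + `|C2| * (1 + `|C3| + r%:R)) => n.
have L0 : 0 <= ln (regR phi n) by apply: ln_ge0; exact: regR_ge1.
rewrite lyapunov_sum.
pose h k := 2 * rls_coef k.+1 * pred_err k.+1.
have s0 : 0 <= \sum_(k < n) h k ^+ 2 by apply: sumr_ge0 => k _; exact: sqr_ge0.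
have {}h1 := martingale_part_le (sqrtr_ge0 _) (h1 n).
rewrite sqr_sqrtr in h1; last by rewrite addr_ge0.
(* h ^ 2 = 4 a ^ 2 u ^ 2 <= 4 a u ^ 2 since a <= 1; this 4 cancels the 1 / 4 of the martingale
   bound. *)
have h4 : \sum_(k < n) h k ^+ 2 <= 4 * \sum_(k < n) rls_coef k.+1 * pred_err k.+1 ^+ 2.
  rewrite mulr_sumr; apply: ler_sum => k _; rewrite /h.
  have /andP[a0 a1] := rls_coef_bounds k.+1.
  have h5 : rls_coef k.+1 * (rls_coef k.+1 * pred_err k.+1 ^+ 2)
      <= rls_coef k.+1 * pred_err k.+1 ^+ 2.
    by rewrite ler_piMl// mulr_ge0 ?sqr_ge0// ltW.
  by lra.
rewrite -/h in h1.
have b0 k : 0 <= 1 - rls_coef k by have /andP[? ?] := rls_coef_bounds k; lra.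
have {}h2 : \sum_(k < n) (1 - rls_coef k.+1) * w k.+2 ^+ 2 <=
    `|C2| * ((1 + `|C3| + r%:R) * (1 + ln (regR phi n))).
  apply: (le_trans (h2 n)).
  apply: (@le_trans _ _ (`|C2| * (1 + \sum_(k < n) (1 - rls_coef k.+1)))).
    by rewrite ler_wpM2r ?ler_norm// addr_ge0// sumr_ge0.
  rewrite ler_wpM2l//.
  have : \sum_(k < n) (1 - rls_coef k.+1) <= \sum_(k < n.+1) (1 - rls_coef k).
    by rewrite big_ord_recl/= lerDr.
  have := h3 n; have := ler_norm C3.
  have : 0 <= `|C3| * ln (regR phi n) by rewrite mulr_ge0.
  have : 0 <= (r%:R : R) by [].
  lra.
have := ler_norm (lyapunov 1).
have : 0 <= D * ln (regR phi n).
  rewrite mulr_ge0// /D; have := normr_ge0 (lyapunov 1); have := sqr_ge0 C1; lra.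
rewrite /h in h4; rewrite /D; lra.
Qed.

(* If the regressors vanished, [ln R_n] would be [0] and could not absorb the
   additive constant. *)
Lemma rls_err_rate : (0 < r)%N -> (exists k, phi k != 0) ->
  (exists C : R, forall n, lyapunov n.+1 <= C * (1 + ln (regR phi n))) ->
  exists C : R, \forall n \near \oo, forall l,
    `|rls_err n.+1 l 0| <= C * Num.sqrt (ln (regR phi n) / reg_lambda_min P0 phi n).
Proof.
move=> r0 [k0 phik0] [C hC].
have R1 : 1 < regR phi k0.
  rewrite /regR big_ord_recr/= addrA.
  apply: (@lt_le_trans _ _ (1 + norm2 (phi k0) ^+ 2)).
    by rewrite ltrDl norm2_sqr dotvv_gt0.
  by rewrite lerD2r lerDl sumr_ge0// => i _; exact: sqr_ge0.
have l0 : 0 < ln (regR phi k0) by exact: ln_gt0.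
(* From [k0] on, 1 <= ln R_n / ln R_k0, so 1 + ln R_n is at most a constant times ln R_n. *)
pose C' := `|C| * (1 + (ln (regR phi k0))^-1).
exists (Num.sqrt C'); exists k0 => // n /= k0n l.
have ln0 : ln (regR phi k0) <= ln (regR phi n).
  by rewrite ler_ln ?posrE ?(lt_le_trans ltr01 (regR_ge1 _))//; exact: regR_mono.
have [lam0 hlam] := lambda_min_posdef (info_mx_posdef n.+1) r0.
have lamE : reg_lambda_min P0 phi n = lambda_min (info_mx n.+1) by [].
rewrite lamE; set lam := lambda_min _ in lam0 hlam *.
have C'0 : 0 <= C' by rewrite mulr_ge0// addr_ge0// invr_ge0 ltW.
rewrite -sqrtrM// -sqrtr_sqr ler_wsqrtr//.
apply: (le_trans (sqr_le_dotvv _ _)).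
rewrite mulrA ler_pdivlMr// mulrC; apply: (le_trans (hlam _)).
apply: (le_trans (hC n)).
have h0 : 0 <= ln (regR phi n) by apply: le_trans ln0; exact: ltW.
apply: (@le_trans _ _ (`|C| * (1 + ln (regR phi n)))).
  by rewrite ler_wpM2r ?ler_norm// addr_ge0.
rewrite /C' -mulrA ler_wpM2l// mulrDl mul1r addrC lerD2l.
by rewrite mulrC ler_pdivlMr// mul1r.
Qed.

(** Eventually the error is below the threshold and every nonzero coordinate exceeds twice the
    threshold, so exactly the zero coordinates are cut. *)
Lemma sparse_est_zero_set (alpha : nat -> R) (C : R) :
  (forall n, 0 < alpha n) -> alpha @ \oo --> (0 : R) ->
  (fun n => Num.sqrt (ln (regR phi n) / reg_lambda_min P0 phi n))
    =o_\oo (fun n => alpha n.+1) ->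
  (\forall n \near \oo, forall l,
    `|rls_err n.+1 l 0| <= C * Num.sqrt (ln (regR phi n) / reg_lambda_min P0 phi n)) ->
  \forall n \near \oo,
    zero_set (sparse_est P0 theta0 phi y alpha n.+1) = zero_set theta.
Proof.
move=> a0 alim /eqoP ao herr.
(* With this constant in the little-o the error is at most half the threshold, hence strictly below
   it. *)
have e0 : 0 < (2 * (`|C| + 1))^-1 by rewrite invr_gt0 mulr_gt0// ltr_wpDl.
have {}ao := ao _ e0.
have asmall : \forall n \near \oo, forall l : 'I_r, theta l 0 != 0 ->
    alpha n.+1 < `|theta l 0| / 2.
  have : \forall n \near \oo, forall l : 'I_r, theta l 0 != 0 ->
      alpha n < `|theta l 0| / 2.
    apply: filter_forall => l.
    have [->|tl] := eqVneq (theta l 0) 0; first exact: nearW.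
    have tl2 : 0 < `|theta l 0| / 2 by rewrite divr_gt0 ?normr_gt0.
    move/cvgrPdist_lt : alim => /(_ _ tl2); apply: filterS => n + _.
    by rewrite sub0r normrN; apply: le_lt_trans; exact: ler_norm.
  by move=> [N _ hN]; exists N => // n /= Nn; exact: hN (leqW Nn).
near=> n.
have err l : `|rls_err n.+1 l 0| < alpha n.+1.
  have h1 : `|rls_err n.+1 l 0| <= C * Num.sqrt (ln (regR phi n) / reg_lambda_min P0 phi n).
    by move: l; near: n; exact: herr.
  have h2 : `|Num.sqrt (ln (regR phi n) / reg_lambda_min P0 phi n)| <=
      (2 * (`|C| + 1))^-1 * `|alpha n.+1|.
    by near: n; exact: ao.
  rewrite (ger0_norm (sqrtr_ge0 _)) (gtr0_norm (a0 n.+1)) in h2.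
  set sq := Num.sqrt _ in h1 h2.
  have sq0 : 0 <= sq by exact: sqrtr_ge0.
  rewrite ler_pdivlMl in h2; last by rewrite mulr_gt0// ltr_wpDl.
  have h3 : C * sq <= `|C| * sq by rewrite ler_wpM2r// ler_norm.
  have := a0 n.+1; lra.
have thn l : rls_theta P0 theta0 phi y n.+1 l 0 = theta l 0 + rls_err n.+1 l 0.
  by rewrite /rls_err !mxE; ring.
apply/seteqP; split => l; rewrite /zero_set /= mxE thn.
  case: ifPn => [lt _|]; last first.
    rewrite -leNgt => ge /eqP; rewrite addr_eq0 => /eqP h; move: ge.
    by rewrite h addNr normr0 leNgt a0.
  apply: contrapT => /eqP tl.
  have h : alpha n.+1 < `|theta l 0| / 2 by move: l tl {lt}; near: n; exact: asmall.
  have := ler_normB (theta l 0 + rls_err n.+1 l 0) (rls_err n.+1 l 0).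
  rewrite addrK; have := err l; lra.
by move=> ->; rewrite add0r err.
Unshelve. all: by end_near. Qed.

End RLSPath.

(** * Almost sure rate of the estimation error *)

Section MeasurableMatrix.
Context (disp : measure_display) (Omega : measurableType disp) (R : realType).
Variable G : set (set Omega).
Hypothesis hG : sigma_algebra setT G.

Definition mx_measurable_wrt m n (A : Omega -> 'M[R]_(m, n)) : Prop :=
  forall i j, measurable_wrt G (fun x => A x i j).

Lemma mx_measurable_wrt_cst m n (A : 'M[R]_(m, n)) :
  mx_measurable_wrt (fun=> A).
Proof. by move=> i j; exact: measurable_wrt_cst. Qed.

Lemma mx_measurable_wrtD m n (A B : Omega -> 'M[R]_(m, n)) :
  mx_measurable_wrt A -> mx_measurable_wrt B ->
  mx_measurable_wrt (fun x => A x + B x).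
Proof.
move=> mA mB i j; rewrite (_ : (fun x => _) = fun x => A x i j + B x i j).
  exact: measurable_wrtD.
by apply/funext => x; rewrite mxE.
Qed.

Lemma mx_measurable_wrtZ m n (f : Omega -> R) (A : Omega -> 'M[R]_(m, n)) :
  measurable_wrt G f -> mx_measurable_wrt A ->
  mx_measurable_wrt (fun x => f x *: A x).
Proof.
move=> mf mA i j; rewrite (_ : (fun x => _) = fun x => f x * A x i j).
  exact: measurable_wrtM.
by apply/funext => x; rewrite mxE.
Qed.

Lemma mx_measurable_wrt_mul m n p (A : Omega -> 'M[R]_(m, n))
    (B : Omega -> 'M[R]_(n, p)) : mx_measurable_wrt A -> mx_measurable_wrt B ->
  mx_measurable_wrt (fun x => A x *m B x).
Proof.
move=> mA mB i j.
rewrite (_ : (fun x => _) = fun x => \sum_k A x i k * B x k j).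
  by apply: measurable_wrt_sum => // k; exact: measurable_wrtM.
by apply/funext => x; rewrite mxE.
Qed.

Lemma mx_measurable_wrt_tr m n (A : Omega -> 'M[R]_(m, n)) :
  mx_measurable_wrt A -> mx_measurable_wrt (fun x => (A x)^T).
Proof.
move=> mA i j; rewrite (_ : (fun x => _) = fun x => A x j i); first exact: mA.
by apply/funext => x; rewrite mxE.
Qed.

Lemma measurable_wrt_dotv n (u v : Omega -> 'cV[R]_n) :
  mx_measurable_wrt u -> mx_measurable_wrt v ->
  measurable_wrt G (fun x => dotv (u x) (v x)).
Proof.
move=> mu mv; apply: (mx_measurable_wrt_mul _ mv) => //.
exact: mx_measurable_wrt_tr.
Qed.

End MeasurableMatrix.

Lemma mx_measurable_wrtS (disp : measure_display) (Omega : measurableType disp)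
    (R : realType) (G H : set (set Omega)) m n (A : Omega -> 'M[R]_(m, n)) :
  G `<=` H -> mx_measurable_wrt G A -> mx_measurable_wrt H A.
Proof. by move=> GH mA i j; exact: measurable_wrtS (mA i j). Qed.

(** * Adaptedness of the recursive least squares quantities *)

Section RLSMeasurability.
Context (disp : measure_display) (Omega : measurableType disp) (R : realType).
Variables (r : nat) (F : nat -> set (set Omega)).
Variables (phi : nat -> Omega -> 'cV[R]_r) (w y : nat -> Omega -> R).
Variables (theta theta0 : 'cV[R]_r) (P0 : 'M[R]_r).
Hypothesis hF : filtration F.
Hypothesis hphi : forall k, mx_measurable_wrt (F k) (phi k).
Hypothesis hw : forall k, (1 <= k)%N -> measurable_wrt (F k) (w k).
Hypothesis hy : forall k x, y k.+1 x = dotv (phi k x) theta + w k.+1 x.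
Hypothesis hP0 : posdefmx P0.

Let coef k x := rls_coef P0 (phi ^~ x) k.

(** Conditional on the measurability of P_k, so as to be usable inside the induction that proves
    it. *)
Lemma rls_coef_measurable_aux k :
  mx_measurable_wrt (F k) (fun x => rls_P P0 (phi ^~ x) k) ->
  measurable_wrt (F k) (coef k).
Proof.
have [sF _ Fm] := hF; move=> mP.
rewrite (_ : coef k = fun x => (1 + dotv (phi k x) (rls_P P0 (phi ^~ x) k *m phi k x))^-1).
  apply: measurable_wrt_inv_ge0 => //.
    move=> x; have /andP[] := rls_coef_bounds (phi ^~ x) hP0 k.
    by rewrite /rls_coef rls_gain_dotv invr_gt0 => /ltW.
  apply: measurable_wrtD => //; first exact: measurable_wrt_cst.
  apply: measurable_wrt_dotv => //; exact: mx_measurable_wrt_mul.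
by apply/funext => x; rewrite /coef /rls_coef rls_gain_dotv.
Qed.

Lemma rls_P_measurable k :
  mx_measurable_wrt (F k) (fun x => rls_P P0 (phi ^~ x) k).
Proof.
have [sF _ Fm] := hF; elim: k => [|k IH] /=; first exact: mx_measurable_wrt_cst.
apply: (@mx_measurable_wrtS _ _ _ (F k)); first exact: Fm.
apply: mx_measurable_wrtD => //.
rewrite (_ : (fun x => _) = fun x => (- coef k x) *:
  (rls_P P0 (phi ^~ x) k *m phi k x *m (phi k x)^T *m rls_P P0 (phi ^~ x) k)).
  apply: mx_measurable_wrtZ => //.
    by apply: measurable_wrtN => //; exact: rls_coef_measurable_aux.
  apply: mx_measurable_wrt_mul => //; apply: mx_measurable_wrt_mul => //.
    exact: mx_measurable_wrt_mul.
  exact: mx_measurable_wrt_tr.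
by apply/funext => x; rewrite scaleNr.
Qed.

Lemma rls_coef_measurable k : measurable_wrt (F k) (coef k).
Proof. by apply: rls_coef_measurable_aux; exact: rls_P_measurable. Qed.

(** The observation y_(k+1) is adapted through the model equation, from the regressor and the
    noise. *)
Lemma rls_theta_measurable k :
  mx_measurable_wrt (F k) (fun x => rls_theta P0 theta0 (phi ^~ x) (y ^~ x) k).
Proof.
have [sF _ Fm] := hF; elim: k => [|k IH] /=; first exact: mx_measurable_wrt_cst.
have up (f : Omega -> R) : measurable_wrt (F k) f -> measurable_wrt (F k.+1) f.
  by apply: measurable_wrtS; exact: Fm.
have mxup n p (A : Omega -> 'M[R]_(n, p)) :
    mx_measurable_wrt (F k) A -> mx_measurable_wrt (F k.+1) A.
  by apply: mx_measurable_wrtS; exact: Fm.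
apply: mx_measurable_wrtD => //; first exact: mxup.
apply: mx_measurable_wrtZ => //.
  apply: measurable_wrtM => //; first exact/up/rls_coef_measurable.
  apply: measurable_wrtB => //; last first.
    by apply: up; exact: measurable_wrt_dotv.
  have -> : y k.+1 = fun x => dotv (phi k x) theta + w k.+1 x by exact/funext.
  apply: measurable_wrtD => //; last exact: hw.
  apply: up; apply: measurable_wrt_dotv => //; exact: mx_measurable_wrt_cst.
by apply: mxup; apply: mx_measurable_wrt_mul => //; exact: rls_P_measurable.
Qed.

Lemma pred_err_measurable k : measurable_wrt (F k)
  (fun x => pred_err P0 theta0 theta (phi ^~ x) (y ^~ x) k).
Proof.
have [sF _ _] := hF; apply: measurable_wrt_dotv => //.
apply: mx_measurable_wrtD => //; first exact: rls_theta_measurable.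
exact: mx_measurable_wrt_cst.
Qed.

End RLSMeasurability.

Lemma patchE_indic (T : Type) (R : realType) (f : T -> R) (D : set T) :
  f \_ D = fun x => f x * \1_D x.
Proof.
by apply/funext => x; rewrite /patch indicE; case: ifP; rewrite ?mulr1 ?mulr0.
Qed.

(** * Noise restricted to the event of a small conditional moment *)

Section TruncatedNoise.
Context (disp : measure_display) (Omega : measurableType disp) (R : realType).
Variables (P : probability Omega R) (G : set (set Omega)).
Variables (v : Omega -> R) (Z : Omega -> \bar R) (gamma : R) (m : R).
Hypotheses (sG : sigma_algebra setT G) (Gm : G `<=` measurable).
Hypothesis mv : measurable_fun setT v.
Hypothesis hZ : is_cond_exp P G (fun x => (`|v x| `^ gamma)%:E) Z.
Hypothesis m0 : 0 <= m.

Definition low_moment : set Omega := [set x | (Z x <= m%:E)%E].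

Lemma low_moment_sub : G low_moment.
Proof.
have [mZ _] := hZ; apply: mZ; exists [set z | (z <= m%:E)%E].
  by rewrite -set_itvNyc; exact: emeasurable_itv.
by rewrite setTI.
Qed.

(** On sets of [G] the moment integrates like its version [Z]. The sign of [Z] is not given, so [Z]
    is replaced by its positive part, which is at most [m] on [B]. *)
Lemma integral_low_moment_le (B : set Omega) : G B -> B `<=` low_moment ->
  (\int[P]_(x in B) (`|v x| `^ gamma)%:E <= m%:E * P B)%E.
Proof.
move=> GB BD; have [mZ <-//] := hZ; have mB := Gm GB.
have mZ' : measurable_fun B Z.
  exact: measurable_funS (measurable_wrt_measurable Gm mZ).
rewrite integralE; apply: (@le_trans _ _ (\int[P]_(x in B) Z^\+ x)%E).
  by rewrite -[leRHS]sube0 leeB// integral_ge0.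
rewrite -integral_cst//; apply: ge0_le_integral => //.
- exact: measurable_funepos.
- by move=> x Bx; rewrite funeposE ge_max lee_fin m0 andbT; exact: BD.
Qed.

Lemma powR_le_1D (t p : R) : 0 <= t -> 0 <= p -> p <= gamma ->
  t `^ p <= 1 + t `^ gamma.
Proof.
move=> t0 p0 pg; have := powR_ge0 t gamma.
have [t1|/ltW t1] := leP t 1.
  have : t `^ p <= 1 `^ p by apply: ge0_ler_powR; rewrite ?nnegrE.
  by rewrite powR1; lra.
have : t `^ p <= t `^ gamma by exact: ler_powR.
by lra.
Qed.

(** On [low_moment] the conditional mean of [zeta] is at most 1 + m by domination, and off it the
    truncated variable is 0. *)
Lemma truncated_drift (zeta : Omega -> R) : measurable_fun setT zeta ->
  (forall x, 0 <= zeta x <= 1 + `|v x| `^ gamma) ->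
  nonpos_drift P G (fun x => (zeta \_ low_moment) x - (m + 1)).
Proof.
move=> mz zle; have GD := low_moment_sub; have mD := Gm GD.
have mvg : measurable_fun setT (fun x => `|v x| `^ gamma).
  by apply: measurableT_comp (measurable_powR _) _; exact: measurableT_comp.
have ivg (B : set Omega) : G B -> B `<=` low_moment ->
    P.-integrable B (EFin \o (fun x => `|v x| `^ gamma)).
  move=> GB BD; apply/integrableP; split.
    by apply/measurable_EFinP; exact: measurable_funS mvg.
  under eq_integral do rewrite /= ger0_norm ?powR_ge0//.
  apply: le_lt_trans (integral_low_moment_le GB BD) _.
  by rewrite ltey_eq fin_numM// fin_num_measure//; exact: Gm.
have i1g (B : set Omega) : G B -> B `<=` low_moment ->
    P.-integrable B (EFin \o (fun x => 1 + `|v x| `^ gamma)).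
  move=> GB BD; have mB := Gm GB.
  have i1 : P.-integrable B (EFin \o cst 1) by exact: finite_measure_integrable_cst.
  by move: (integrableD mB i1 (ivg _ GB BD)); apply: eq_integrable.
have iz (B : set Omega) : G B -> B `<=` low_moment -> P.-integrable B (EFin \o zeta).
  move=> GB BD; apply: le_integrable (i1g B GB BD); first exact: Gm.
    by apply/measurable_EFinP; apply: measurable_funS mz.
  move=> x _ /=; have /andP[z0 z1] := zle x.
  by rewrite lee_fin (ger0_norm z0) (ger0_norm (le_trans z0 z1)).
have izD (A : set Omega) : measurable A -> P.-integrable A (EFin \o (zeta \_ low_moment)).
  move=> mA; apply: (@integrableS _ _ _ _ setT) => //.
  by rewrite -restrict_EFin; apply: (integrable_mkcond (EFin \o zeta) mD).1; exact: iz.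
have icst (A : set Omega) : measurable A -> P.-integrable A (EFin \o cst (m + 1)).
  by move=> mA; exact: finite_measure_integrable_cst.
split.
  move: (integrableB measurableT (izD _ measurableT) (icst _ measurableT)).
  exact: eq_integrable.
move=> A GA; have mA := Gm GA.
rewrite (RintegralB mA (izD _ mA) (icst _ mA)) Rintegral_cst// subr_le0.
rewrite -Rintegral_mkcondr; set B := A `&` low_moment.
have GB : G B by exact: sigma_algebraI_sub.
have BD : B `<=` low_moment by move=> x [].
have mB := Gm GB.
apply: (@le_trans _ _ (\int[P]_(x in B) (1 + `|v x| `^ gamma))).
  by apply: le_Rintegral => //; [exact: iz|exact: i1g|move=> x _; have /andP[] := zle x].
have i1 : P.-integrable B (EFin \o cst 1) by exact: finite_measure_integrable_cst.
rewrite (RintegralD mB i1 (ivg _ GB BD)) Rintegral_cst// mul1r.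
have h1 : \int[P]_(x in B) `|v x| `^ gamma <= m * fine (P B).
  rewrite /Rintegral -lee_fin fineK ?integrable_fin_num//; last exact: ivg.
  rewrite EFinM fineK ?fin_num_measure//; exact: integral_low_moment_le.
have h2 : fine (P B) <= fine (P A).
  by rewrite fine_le ?fin_num_measure// le_measure ?inE// => x [].
have h3 : 0 <= fine (P B) by exact: fine_ge0.
have := ler_wpM2l m0 h2; lra.
Qed.

(** Intersecting a set of [G] with [low_moment] stays in [G], so truncation preserves zero
    integrals. Both signs are recorded since the drift condition is one-sided. *)
Lemma truncated_martingale_drift : P.-integrable setT (EFin \o v) ->
  is_cond_exp P G (EFin \o v) (cst 0%E) ->
  nonpos_drift P G (v \_ low_moment) /\
  nonpos_drift P G (fun x => - (v \_ low_moment) x).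
Proof.
move=> iv [_ cv]; have GD := low_moment_sub; have mD := Gm GD.
have iD : P.-integrable setT (EFin \o (v \_ low_moment)).
  by rewrite -restrict_EFin; apply: (integrable_mkcond (EFin \o v) mD).1;
    exact: integrableS iv.
have i0 A : G A -> \int[P]_(x in A) (v \_ low_moment) x = 0.
  move=> GA; rewrite -Rintegral_mkcondr /Rintegral.
  by rewrite -[X in fine X]cv ?integral0//; exact: sigma_algebraI_sub.
split; split => //.
- by move=> A /i0 ->.
- by move: (integrableN iD); apply: eq_integrable.
- move=> A GA; have mA := Gm GA.
  rewrite (@eq_Rintegral _ _ _ _ _ (fun x => (-1) * (v \_ low_moment) x)).
    by rewrite RintegralZl// ?i0 ?mulr0//; exact: integrableS iD.
  by move=> x _; rewrite mulN1r.
Qed.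

End TruncatedNoise.

(** * Logarithmic growth of the Lyapunov function on almost every path *)

Section AlmostSureRate.
Context (disp : measure_display) (Omega : measurableType disp) (R : realType).
Variables (P : probability Omega R) (r : nat) (F : nat -> set (set Omega)).
Variables (phi : nat -> Omega -> 'cV[R]_r) (w y : nat -> Omega -> R).
Variables (theta theta0 : 'cV[R]_r) (P0 : 'M[R]_r) (gamma : R).
Hypothesis hF : filtration F.
Hypothesis hphi : forall k, mx_measurable_wrt (F k) (phi k).
Hypothesis hy : forall k x, y k.+1 x = dotv (phi k x) theta + w k.+1 x.
Hypothesis hP0 : posdefmx P0.
Hypothesis hw : martingale_difference P F w.
Hypothesis hgamma : 2 < gamma.

Let coef k x := rls_coef P0 (phi ^~ x) k.
Let perr k x := pred_err P0 theta0 theta (phi ^~ x) (y ^~ x) k.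

Lemma truncated_noise_growth (Z : nat -> Omega -> \bar R) (m : R) : 0 <= m ->
  (forall k, (1 <= k)%N -> is_cond_exp P (F k)
     (fun x => (`|w k.+1 x| `^ gamma)%:E) (Z k)) ->
  let e n := w n.+2 \_ (low_moment (Z n.+1) m) in
  {ae P, forall x, (exists C : R, forall n : nat,
    let h k := 2 * coef k.+1 x * perr k.+1 x in
    (\sum_(k < n) h k * e k x) ^+ 2 <=
      C * Num.sqrt (1 + \sum_(k < n) h k ^+ 2) ^+ 3) /\
    exists C : R, forall n : nat,
    \sum_(k < n) (1 - coef k.+1 x) * e k x ^+ 2 <=
      C * (1 + \sum_(k < n) (1 - coef k.+1 x))}.
Proof.
move=> m0 hZ e.
have [sF Fm Fmono] := hF; have [mw iw cw] := hw.
have sG n := sF n.+1; have Gm n := Fm n.+1.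
have mv n : measurable_fun setT (w n.+2).
  exact: measurable_wrt_measurable (Fm n.+2) (mw n.+2 isT).
have hZn n := hZ n.+1 isT.
have hG : filtration (fun n => F n.+1).
  by split=> // j k jk; exact: Fmono.
have mcoef k : measurable_wrt (F k) (coef k) by exact: rls_coef_measurable.
have mperr k : measurable_wrt (F k) (perr k).
  have := @pred_err_measurable _ _ _ _ _ phi w y theta theta0 P0 hF hphi mw hy hP0 k.
  exact.
have lowG n : F n.+1 (low_moment (Z n.+1) m) by exact: low_moment_sub (hZn n).
have me n : measurable_wrt (F n.+2) (e n).
  rewrite /e patchE_indic; apply: measurable_wrtM => //; first exact: mw.
  by apply: measurable_wrt_indic => //; exact: (Fmono n.+1).
have e2E n x : e n x ^+ 2 = ((fun x => w n.+2 x ^+ 2) \_ (low_moment (Z n.+1) m)) x.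
  by rewrite /e /patch; case: ifP => // _; rewrite expr0n.
have g2 := hgamma; have g0 : 0 <= gamma by lra.
have de2 n : nonpos_drift P (F n.+1) (fun x => e n x ^+ 2 - (m + 1)).
  under [X in nonpos_drift _ _ X]funext do rewrite e2E.
  apply: (truncated_drift (sG n) (Gm n) (mv n) (hZn n) m0).
    exact: measurable_funX.
  move=> x; rewrite sqr_ge0/= -real_normK ?num_real// -powR_mulrn//.
  by apply: powR_le_1D => //; lra.
(* Chosen so that 0 < q <= 1 and 2 (1 + q) <= gamma: the power 1 + q of the squared noise is then
   controlled by the moment of order gamma. *)
pose q := Num.min (gamma / 2) 2 - 1.
have q0 : 0 < q by rewrite subr_gt0 lt_min; apply/andP; split; lra.
have q1 : q <= 1 by rewrite lerBlDr ge_min; apply/orP; right; lra.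
have qg : 2 * (1 + q) <= gamma.
  have : q <= gamma / 2 - 1 by rewrite lerB// ge_min lexx.
  by lra.
have dep n : nonpos_drift P (F n.+1) (fun x => (e n x ^+ 2) `^ (1 + q) - (m + 1)).
  have -> : (fun x => (e n x ^+ 2) `^ (1 + q) - (m + 1)) = fun x =>
      ((fun x => (w n.+2 x ^+ 2) `^ (1 + q)) \_ (low_moment (Z n.+1) m)) x - (m + 1).
    apply/funext => x; congr (_ - _); rewrite /e /patch; case: ifP => // _.
    by rewrite expr0n/= powR0// gt_eqF//; lra.
  apply: (truncated_drift (sG n) (Gm n) (mv n) (hZn n) m0).
    by apply: measurableT_comp (measurable_powR _) _; exact: measurable_funX.
  move=> x; rewrite powR_ge0/= -real_normK ?num_real// -powR_mulrn// -powRrM.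
  by apply: powR_le_1D => //; lra.
have dm n := truncated_martingale_drift m (sG n) (Gm n) (hZn n) (iw n.+2 isT) (cw n.+1 isT).
have T1 := @martingale_transform_growth _ _ _ P _ hG e
  (fun k x => 2 * coef k.+1 x * perr k.+1 x) (m + 1) ltac:(lra) me _
  (fun n => (dm n).1) (fun n => (dm n).2) de2.
have T2 := @weighted_sum_growth _ _ _ P _ hG (fun k x => 1 - coef k.+1 x)
  (fun n x => e n x ^+ 2) q (m + 1) q0 q1 ltac:(lra) _ _ _ _ de2 dep.
apply: filterI.
- apply: T1 => n; apply: measurable_wrtM => //; apply: measurable_wrtM => //.
  exact: measurable_wrt_cst.
- apply: T2 => [n|n|n x|n x].
  + exact: measurable_wrtX.
  + by apply: measurable_wrtB => //; exact: measurable_wrt_cst.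
  + have /andP[] := rls_coef_bounds (phi ^~ x) hP0 n.+1; rewrite /coef => *.
    by apply/andP; split; lra.
  + exact: sqr_ge0.
Qed.

(** On almost every path all conditional moments lie below some integer [m]; for that [m] the
    truncation never acts, and the truncated bounds are bounds for [w] itself. *)
Lemma lyapunov_growth_ae : bounded_cond_moment P F w gamma ->
  {ae P, forall x, exists C : R, forall n,
    lyapunov P0 theta0 theta (phi ^~ x) (y ^~ x) n.+1 <=
      C * (1 + ln (regR (phi ^~ x) n))}.
Proof.
move=> [Z [hZ Zoo]].
(* Natural levels [m] suffice, so only countably many null sets are discarded. *)
have T m := truncated_noise_growth (ler0n R m) hZ.
apply: filterS2 Zoo (ae_foralln T) => x Zx Tx.
have [m Zm] : exists m : nat, forall n, (Z n.+1 x <= (m%:R : R)%:E)%E.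
  have [M ZM] : exists M : R, (ereal_sup [set Z k x | k in [set k | (1 <= k)%N]] <= M%:E)%E.
    case: (ereal_sup _) Zx => [M| |] //; first by exists M.
    by exists 0; rewrite leNye.
  exists (Num.truncn M).+1 => n; apply: le_trans (_ : (M%:E <= _)%E).
    by apply: le_trans ZM; apply: ereal_sup_ubound; exists n.+1.
  by rewrite lee_fin; exact/ltW/truncnS_gt.
have eE n : (w n.+2 \_ (low_moment (Z n.+1) m%:R)) x = w n.+2 x.
  by rewrite patchT// inE; exact: Zm.
have [[C1 H1] [C2 H2]] := Tx m.
apply: (lyapunov_growth (w := w ^~ x) hP0 (fun k => hy k x)).
- exists C1 => n /=; have := H1 n; cbv zeta.
  rewrite (eq_bigr (fun k : 'I_n => 2 * coef k.+1 x * perr k.+1 x * w k.+2 x)) => [//|k _].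
  by rewrite eE.
- exists C2 => n /=; have := H2 n.
  rewrite (eq_bigr (fun k : 'I_n => (1 - coef k.+1 x) * w k.+2 x ^+ 2)) => [//|k _].
  by rewrite eE.
Qed.

End AlmostSureRate.

Theorem theorem2 (R : realType) (disp : measure_display)
  (Omega : measurableType disp) (P : probability Omega R)
  (r d : nat)
  (F : nat -> set (set Omega))
  (phi : nat -> Omega -> 'cV[R]_r) (w y : nat -> Omega -> R)
  (theta theta0 : 'cV[R]_r) (P0 : 'M[R]_r)
  (alpha : nat -> Omega -> R) (gamma : R)
  (* sparsity pattern of theta: coordinates 0, ..., d-1 are the nonzero ones *)
  (hd : (d <= r)%N)
  (htheta_nz : forall i : 'I_r, (i < d)%N -> theta i 0 != 0)
  (htheta_z : forall i : 'I_r, (d <= i)%N -> theta i 0 = 0)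
  (* the stochastic regression model *)
  (hF : filtration F)
  (hphi : forall k (i : 'I_r), measurable_wrt (F k) (fun x => phi k x i 0))
  (hy : forall k x, y k.+1 x = ((phi k x)^T *m theta) 0 0 + w k.+1 x)
  (hP0 : posdefmx P0)
  (* assumption (i) *)
  (hw : martingale_difference P F w)
  (hgamma : 2 < gamma)
  (hmom : bounded_cond_moment P F w gamma)
  (* assumption (ii) *)
  (hlambda : {ae P, forall x,
     (fun n => ln (regR (phi ^~ x) n) / reg_lambda_min P0 (phi ^~ x) n)
       @ \oo --> (0 : R)})
  (* nondegeneracy: if all regressors vanish then ln R_n = 0, so that (ii) and
     the rate condition below hold trivially while theta_n = theta_0 *)
  (hphi_nz : {ae P, forall x, exists k, phi k x != 0})
  (* thresholds; theta_{n+1}, computed from phi_0, ..., phi_n, is compared with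
     alpha_{n+1}, hence the index in the rate condition *)
  (halpha_pos : {ae P, forall x, forall n, 0 < alpha n x})
  (halpha_lim : {ae P, forall x, alpha ^~ x @ \oo --> (0 : R)})
  (halpha_rate : {ae P, forall x,
     (fun n => Num.sqrt (ln (regR (phi ^~ x) n)
                         / reg_lambda_min P0 (phi ^~ x) n))
       =o_\oo (fun n => alpha n.+1 x)}) :
  let beta n x :=
    sparse_est P0 theta0 (phi ^~ x) (y ^~ x) (alpha ^~ x) n in
  exists Omega0 : set Omega,
    [/\ measurable Omega0, P Omega0 = 1%E &
      forall x, Omega0 x -> exists N0 : nat, forall N : nat, (N0 <= N)%N ->
        (forall l : 'I_r, (d <= l)%N -> beta N.+1 x l 0 = 0) /\
        zero_set (beta N.+1 x) = zero_set theta].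
Proof.
move=> beta.
have hphi' k : mx_measurable_wrt (F k) (phi k) by move=> i j; rewrite ord1; exact: hphi.
have hlyap := lyapunov_growth_ae theta0 hF hphi' hy hP0 hw hgamma hmom.
have conv : {ae P, forall x, exists N0 : nat, forall N : nat, (N0 <= N)%N ->
    zero_set (beta N.+1 x) = zero_set theta}.
  apply: filterS2 (filterI hlyap hphi_nz)
    (filterI halpha_pos (filterI halpha_lim halpha_rate)) => x.
  move=> [hV [k phik]] [apos [alim arate]].
  (* A nonzero regressor excludes dimension 0, where there is no smallest eigenvalue. *)
  have r0 : (0 < r)%N.
    rewrite lt0n; apply/eqP => r0; move/eqP: phik; apply.
    by apply/matrixP => i; have := ltn_ord i; rewrite {2}r0.
  have [C hC] := rls_err_rate hP0 r0 (ex_intro _ k phik) hV.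
  have [N0 _ hN0] := sparse_est_zero_set apos alim arate hC.
  by exists N0 => N /hN0.
(* [A] is a measurable null set containing all exceptional points; its complement is measurable
   whether or not the convergence event is. *)
have [A [mA PA0 convA]] := conv.
exists (~` A); split.
- exact: measurableC.
- by rewrite probability_setC// PA0 sube0.
move=> x nAx; have [N0 hN0] : exists N0 : nat, forall N : nat, (N0 <= N)%N ->
    zero_set (beta N.+1 x) = zero_set theta.
  by apply: contrapT => h; apply: nAx; exact: convA.
exists N0 => N /hN0 hN; split=> // l dl.
have : zero_set theta l by rewrite /zero_set /= htheta_z.
by rewrite -hN.
Qed.
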